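(* Let $\mathbb{G}$ be a Carnot group, identified with $\mathbb{R}^n$ via exponential coordinates of the first kind and equipped with the Carnot–Carathéodory distance $d_c$. Then there exists a closed nowhere dense set $A\subset\mathbb{G}$ which has measure zero (with respect to Lebesgue measure $\mathcal{L}^n$ on $\mathbb{R}^n$, which is a Haar measure on $\mathbb{G}$) but is not $\sigma$-porous with respect to $d_c$.
   Context: A Carnot group of step $s$ is a simply connected finite-dimensional Lie group $\mathbb{G}$ whose Lie algebra decomposes as $\mathfrak{g}=V_1\oplus\cdots\oplus V_s$ with non-zero linear subspaces $V_i$, $[V_1,V_i]=V_{i+1}$ for $1\le i\le s-1$ and $[V_1,V_s]=\{0\}$, where $[V,W]=\mathrm{span}\{[X,Y]:X\in V,Y\in W\}$. Fix a basis $X_1,\dots,X_n$ of $\mathfrak{g}$ (left-invariant vector fields) adapted to the stratification (a basis of $V_{i+1}$ follows a basis of $V_i$ for each $i$), and let $m=\dim V_1$, so $X_1,\dots,X_m$ is a basis of $V_1$. The point $\exp(x_1X_1+\dots+x_nX_n)$ is identified with $(x_1,\dots,x_n)\in\mathbb{R}^n$ (exponential coordinates of the first kind); the identity is $0$. An absolutely continuous curve $\gamma:[a,b]\to\mathbb{G}$ is horizontal if there are $u_1,\dots,u_m\in L^1[a,b]$ with $\gamma'(t)=\sum_{i=1}^m u_i(t)X_i(\gamma(t))$ for a.e. $t$; its length is $L(\gamma)=\int_a^b|u(t)|\,dt$, where $u=(u_1,\dots,u_m)$ and $|\cdot|$ is the Euclidean norm. The Carnot–Carathéodory distance is $d_c(x,y)=\inf\{L(\gamma):\gamma:[0,1]\to\mathbb{G}\text{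 horizontal joining }x\text{ to }y\}$. It induces the Euclidean topology on $\mathbb{R}^n$. Porosity: let $(M,d)$ be a metric space, $E\subset M$, $B(x,r)$ the open ball. For $\lambda\in(0,1)$ and $a\in E$, $E$ is $\lambda$-porous at $a$ if there is a sequence of points $x_k\in M\setminus\{a\}$ with $x_k\to a$ and $B(x_k,\lambda d(x_k,a))\cap E=\varnothing$ for every $k$. $E$ is porous if there is $\lambda\in(0,1)$ (independent of the point) such that $E$ is $\lambda$-porous at every $a\in E$. A set is $\sigma$-porous if it is a countable union of porous sets. *)

(* Defs.v *)
(* Points of R^n are row vectors in 'rV[R]_n. *)
From HB Require Import structures.
From mathcomp Require Import all_boot all_order all_algebra.
From mathcomp Require Import all_classical all_reals all_analysis.
Set Implicit Arguments.
Unset Strict Implicit.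
Unset Printing Implicit Defensive.
Import Order.TTheory GRing.Theory Num.Theory.
Import numFieldNormedType.Exports.
Local Open Scope classical_set_scope.
Local Open Scope ring_scope.

Definition lin_span (R : realType) (V : lmodType R) (S : set V) : set V :=
  [set v | exists (k : nat) (c : 'I_k -> R) (f : 'I_k -> V),
     (forall i, S (f i)) /\ v = \sum_(i < k) c i *: f i].

(* In finite dimension, being C^k is equivalent to this requirement on all the
   iterated directional derivatives. *)
Fixpoint Ck (R : realType) (V W : normedModType R) (k : nat) (f : V -> W) :
    Prop :=
  if k is k'.+1 then
    continuous f /\
    forall v : V, (forall x, derivable f x v) /\ Ck k' ('D_v f)
  else continuous f.

Definition smooth (R : realType) (V W : normedModType R) (f : V -> W) : Prop :=
  forall k, Ck k f.

Section vector_fields.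
Context {R : realType} {n : nat}.
Local Notation E := 'rV[R]_n.

(* A vector field is a map E -> E; the bracket is the commutator of the
   associated derivations, (XY - YX) f. *)
Definition lie_bracket (X Y : E -> E) : E -> E :=
  fun x => 'D_(X x) Y x - 'D_(Y x) X x.

Definition bracket_span (A B : set (E -> E)) : set (E -> E) :=
  lin_span [set lie_bracket X Y | X in A & Y in B].

(* The left-invariant vector field of the group law mul (with identity 0)
   whose value at 0 is the i-th vector of the standard basis. *)
Definition left_inv_field (mul : E -> E -> E) (i : 'I_n) : E -> E :=
  fun x => 'D_(delta_mx 0 i) (mul x) 0.

(* The layer V_k, spanned by the basis fields of degree k. *)
Definition layer_of (mul : E -> E -> E) (deg : 'I_n -> nat) (k : nat) :
    set (E -> E) :=
  lin_span [set left_inv_field mul i | i in [set i | deg i = k]].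

End vector_fields.

(* A Carnot group of step s read in exponential coordinates of the first kind
   associated with an adapted basis X_1, ..., X_n: a Lie group structure on the
   manifold R^n.  The basis field X_i belongs to the layer V_(deg i), so that
   the Lie algebra is the direct sum of the layers V_1, ..., V_s. *)
Record carnotGroup (R : realType) (n s : nat) := CarnotGroup {
  cmul : 'rV[R]_n -> 'rV[R]_n -> 'rV[R]_n ;
  cinv : 'rV[R]_n -> 'rV[R]_n ;
  cmulA : associative cmul ;
  cmul0x : left_id 0 cmul ;
  cmulx0 : right_id 0 cmul ;
  cmulVx : left_inverse 0 cinv cmul ;
  cmulxV : right_inverse 0 cinv cmul ;
  cmul_smooth : smooth (fun p : 'rV[R]_n * 'rV[R]_n => cmul p.1 p.2) ;
  cinv_smooth : smooth cinv ;
  (* exp (t (x_1 X_1 + ... + x_n X_n)) = t x : the right-hand side is the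
     integral curve of x_1 X_1 + ... + x_n X_n through the identity *)
  cexp : forall (x : 'rV[R]_n) (t : R),
    is_derive t 1 (fun r : R => r *: x)
      ((\sum_(i < n) x 0 i *: left_inv_field cmul i) (t *: x)) ;
  cdeg : 'I_n -> nat ;
  cdeg_adapted : forall i j : 'I_n, (i <= j)%N -> (cdeg i <= cdeg j)%N ;
  cdeg_range : forall i, (1 <= cdeg i <= s)%N ;
  cstep_gt0 : (0 < s)%N ;
  clayer_neq0 : forall k, (1 <= k <= s)%N -> exists i, cdeg i = k ;
  cbracket : forall k, (1 <= k < s)%N ->
    bracket_span (layer_of cmul cdeg 1) (layer_of cmul cdeg k) =
    layer_of cmul cdeg k.+1 ;
  cbracket_top :
    bracket_span (layer_of cmul cdeg 1) (layer_of cmul cdeg s) = [set 0]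
}.

Section carnot_caratheodory.
Context {R : realType} {n : nat}.
Local Notation E := 'rV[R]_n.
Local Notation mu := (@lebesgue_measure R).

Definition abs_continuous (a b : R) (g : R -> E) : Prop :=
  forall e : R, 0 < e -> exists2 d : R, 0 < d &
    forall (N : nat) (p q : 'I_N -> R),
      (forall i, a <= p i /\ p i <= q i /\ q i <= b) ->
      trivIset setT (fun i => `]p i, q i[%classic) ->
      \sum_(i < N) (q i - p i) < d ->
      \sum_(i < N) `|g (q i) - g (p i)| < e.

Context {s : nat} (G : carnotGroup R n s).

(* Only the components u i with cdeg G i = 1 (i.e. i among the m = dim V_1
   first indices) are controls; the others are ignored. *)
Definition horizontal (a b : R) (g : R -> E) (u : 'I_n -> R -> R) : Prop :=
  [/\ abs_continuous a b g,
      (forall i, cdeg G i = 1%N -> mu.-integrable `[a, b] (EFin \o u i)) &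
      {ae mu, forall t : R, t \in `[a, b] ->
        is_derive t 1 g
          (\sum_(i < n | cdeg G i == 1%N) u i t *:
             left_inv_field (cmul G) i (g t))}].

Definition hlength (a b : R) (u : 'I_n -> R -> R) : \bar R :=
  (\int[mu]_(t in `[a, b])
     (Num.sqrt (\sum_(i < n | cdeg G i == 1%N) u i t ^+ 2))%:E)%E.

(* Extended-real valued: an infimum over no curve is +oo.  That this never
   happens in a Carnot group is Chow's theorem, which is not presupposed. *)
Definition cc_dist (x y : E) : \bar R :=
  ereal_inf [set l | exists (g : R -> E) (u : 'I_n -> R -> R),
    [/\ horizontal 0 1 g u, g 0 = x, g 1 = y & l = hlength 0 1 u]].

End carnot_caratheodory.

Section porosity.
Context {R : realType} {M : Type} (d : M -> M -> \bar R).

Definition dball (x : M) (r : \bar R) : set M := [set y | (d x y < r)%E].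

Definition porous_at (lambda : R) (S : set M) (a : M) : Prop :=
  exists x : nat -> M,
    [/\ forall k, x k <> a,
        d (x k) a @[k --> \oo] --> 0%E &
        forall k, dball (x k) (lambda%:E * d (x k) a)%E `&` S = set0].

Definition porous (S : set M) : Prop :=
  exists lambda : R,
    [/\ 0 < lambda, lambda < 1 & forall a, S a -> porous_at lambda S a].

Definition sigma_porous (S : set M) : Prop :=
  exists F : nat -> set M, (forall k, porous (F k)) /\ S = \bigcup_k F k.

End porosity.

(* n-dimensional Lebesgue (outer) measure, from countable covers by closed
   boxes; it coincides with the measure L^n on Lebesgue-measurable sets, in
   particular on closed sets. *)
Definition lebesgue_outer (R : realType) (n : nat) (A : set 'rV[R]_n) :
    \bar R :=
  ereal_inf [set l | exists a b : nat -> 'rV[R]_n,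
    [/\ forall k i, a k 0 i <= b k 0 i,
        A `<=` \bigcup_k [set x | forall i, a k 0 i <= x 0 i <= b k 0 i] &
        l = (\sum_(k <oo) (\prod_(i < n) (b k 0 i - a k 0 i))%:E)%E]].

Definition nowhere_dense (T : topologicalType) (A : set T) : Prop :=
  interior (closure A) = set0.

(* Main.v *)
Require Import Defs.
From HB Require Import structures.
From mathcomp Require Import all_boot all_order all_algebra.
From mathcomp Require Import all_classical all_reals all_analysis.
From mathcomp Require Import measurable_realfun ring lra zify.
Import Order.TTheory GRing.Theory Num.Theory.
Import numFieldNormedType.Exports.
Set Implicit Arguments.
Unset Strict Implicit.
Unset Printing Implicit Defensive.
Local Open Scope classical_set_scope.
Local Open Scope ring_scope.

(** Fix a vector e of the standard basis that lies in the first layer and let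
    pi be the corresponding coordinate.  Near the identity pi is, up to
    constants, a Lipschitz quotient from (G, d_c) onto the line:
    - [pi] is Lipschitz, because the left-invariant fields are bounded near 0,
      so that a short horizontal curve moves little in the Euclidean norm
      ([norm_le_cc_dist]);
    - from every x one can change pi by t at cost at most 2 |t|, by running
      along the left translate x * (tau e) of the axis, which is horizontal and
      along which pi has slope close to 1 ([cc_dist_move_coord]).
    Hence a d_c-ball avoiding the preimage under pi of a closed set T of the
    line projects onto an interval avoiding T: where T is not porous, neither
    is its preimage.  The set A is the part of pi^-1(T) in a compact box, for a
    closed null set T of the line chosen as follows.

    Let the meshes delta_m decrease so fast that delta_(m+1) = delta_m/(m+8)^2,
    and let T_e be the set of the points at distance at least e_m delta_m from
    the grid delta_m Z, for every m.  With e_m = 1/(m+8) this is null, since the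
    proportion kept at each scale is at most (m+7)/(m+8), a telescoping product
    ([far_cover]), and it has no interior.  If e < e' and e_m/e'_m tends to 0,
    then T_e is not porous at any point a of T_e': the grids coarser than the
    scale h of a hole stay away from a by e'_m delta_m, more than h, and the
    first grid that comes closer removes too small a proportion around it to
    fill a ball of radius lam h ([robust_near]).

    That A is not a countable union of porous sets P_k is a Baire category
    argument in the metric d_c.  One constructs nested d_c-balls B(x_k, r_k) and
    increasing sequences e_k such that no point of B(x_k, r_k) over T_(e_k) lies
    in P_0, ..., P_(k-1) ([escape_porous]).  If some small ball around a point
    over T_(e_k) misses P_k, one moves there.  Otherwise P_k is dense over
    T_(e_k) near x_k; a hole of P_k is then a hole of the preimage of T_(e_k),
    and none exists near the points over T_e' for a slightly larger e', so that
    it suffices to replace e_k by e'.  The density is used only at robust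
    points, where all inequalities defining T_(e_k) are strict and eventually
    hold with the constant 1/4: around them T_(e_k) contains the sets T_e' that
    the next step needs.

    The limit of the x_k exists and lies in all the balls because d_c is
    complete for summable sequences of short steps ([cc_dist_complete]): the
    curves joining x_k to x_(k+1) are run successively on the intervals
    [1 - 2^-k, 1 - 2^-(k+1)], and the resulting curve on [0, 1] is absolutely
    continuous because its increments are controlled by the integral of its
    speed.  The same concatenation gives the triangle inequality.  Both the
    Lipschitz bound and this control rest on the fact that an absolutely
    continuous function whose derivative is at most phi almost everywhere
    increases by at most the integral of phi ([ac_ae_le]). *)

(** * First-order expansions and Cousin's lemma *)

Section derive_expansion.
Context {R : realType} {V : normedModType R}.

Lemma is_derive_expansion (f : R -> V) (t : R) (v : V) :
  is_derive t 1 f v -> forall e : R, 0 < e -> exists2 d : R, 0 < d &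
  forall s, `|s - t| < d -> `|f s - f t - (s - t) *: v| <= e * `|s - t|.
Proof.
move=> [df dfv] e e0.
have H : h^-1 *: (f (h *: (1:R) + t) - f t) @[h --> (0:R)^'] --> v.
  by move: df; rewrite -dfv /derive => /cvgP.
move/cvgrPdist_lt : H => /(_ _ e0)[d /= d0 Hd].
exists d => // s st.
have [->|nst] := eqVneq s t; first by rewrite !subrr scale0r subr0 !normr0 mulr0.
have h0 : s - t != 0 by rewrite subr_eq0.
have := Hd (s - t); rewrite /= sub0r normrN => /(_ st h0).
rewrite [_%:A]mulr1 subrK => H.
rewrite -[f s - f t](scalerKV h0) -scalerBr normrZ mulrC ler_wpM2r //.
by rewrite distrC ltW.
Qed.

Lemma expansion_is_derive (f : R -> V) (t : R) (v : V) :
  (forall e : R, 0 < e -> exists2 d : R, 0 < d &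
  forall s, `|s - t| < d -> `|f s - f t - (s - t) *: v| <= e * `|s - t|) ->
  is_derive t 1 f v.
Proof.
move=> H.
have K : h^-1 *: (f (h *: (1:R) + t) - f t) @[h --> (0:R)^'] --> v.
  apply/cvgrPdist_le => e e0; have [d d0 Hd] := H _ e0.
  exists d => //= h; rewrite /= sub0r normrN => hd h0.
  have := Hd (h + t); rewrite addrK => /(_ hd) Hh.
  rewrite [_%:A]mulr1 distrC -{1}[v](scalerK h0) -scalerBr normrZ normfV.
  by rewrite ler_pdivrMl ?normr_gt0// mulrC.
split; first by apply: cvgP K.
exact/cvg_lim.
Qed.
End derive_expansion.

Section cousin.
Context {R : realType}.

(** Induction on the line: the supremum of the y for which [Q a y] holds is
    attained, and passed unless it is b, by the local hypothesis there.  It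
    turns pointwise information of mixed nature into information on [a, b]
    without choosing a partition. *)
Lemma cousin (Q : R -> R -> Prop) (a b : R) : a <= b ->
  (forall x y z, a <= x -> x <= y -> y <= z -> z <= b -> Q x y -> Q y z -> Q x z) ->
  (forall t, a <= t <= b -> exists2 d : R, 0 < d &
    forall p q, a <= p -> p <= t -> t <= q -> q <= b -> t - d < p -> q < t + d -> Q p q) ->
  Q a b.
Proof.
move=> ab Qtrans Qloc.
pose S := [set y | a <= y <= b /\ Q a y].
have Sa : S a.
  split; first by rewrite lexx.
  have [|d d0 H] := Qloc a; first by rewrite lexx.
  by apply: H; rewrite ?lexx//; lra.
have Sub : ubound S b by move=> y [/andP[]].
have hS : has_sup S by split; [exists a | exists b].
have ac : a <= sup S by apply: ub_le_sup => //; exact: (proj2 hS).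
have cb : sup S <= b by apply: ge_sup => //; exact: (proj1 hS).
have [|d d0 Hd] := Qloc (sup S); first by rewrite ac cb.
have [y [/andP[ay yb] Qay] yc] := sup_adherent d0 hS.
have yS : y <= sup S by apply: ub_le_sup; [exact: (proj2 hS) | split; rewrite ?ay].
have Qaq q : sup S <= q -> q <= b -> q < sup S + d -> Q a q.
  move=> cq qb qd; have yq := le_trans yS cq.
  by apply: (Qtrans a y q) => //; apply: Hd => //; lra.
have [cb'|bc] := ltP (sup S) b; last first.
  by apply: Qaq => //; lra.
pose q := Num.min b (sup S + d / 2).
have cq : sup S < q by rewrite lt_min cb' /=; lra.
have qb : q <= b by rewrite ge_min lexx.
have qd : q < sup S + d by rewrite gt_min; apply/orP; right; lra.
have : q <= sup S.
  by apply: ub_le_sup; [exact: (proj2 hS) | split; [rewrite qb (le_trans ac (ltW cq)) | exact: Qaq (ltW cq) qb qd]].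
by rewrite leNgt cq.
Qed.
End cousin.

(** * Absolutely continuous functions *)

Section ac.
Context {R : realType}.
Local Notation mu := (@lebesgue_measure R).

(** Absolute continuity with values in any normed module, so that it applies
    both to a curve and to its coordinates. *)
Definition ac_on {V : normedModType R} (a b : R) (f : R -> V) : Prop :=
  forall e : R, 0 < e -> exists2 d : R, 0 < d &
    forall (N : nat) (p q : 'I_N -> R),
      (forall i, a <= p i /\ p i <= q i /\ q i <= b) ->
      trivIset setT (fun i => `]p i, q i[%classic) ->
      \sum_(i < N) (q i - p i) < d ->
      \sum_(i < N) `|f (q i) - f (p i)| < e.

Lemma negligible_open_cover (N : set R) (d : R) : mu.-negligible N -> 0 < d ->
  exists U : set R, [/\ open U, N `<=` U & (mu U < d%:E)%E].
Proof.
move=> [M [mM M0 NM]] d0.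
have [|U [oU MU UM]] := @lebesgue_regularity_outer R M d mM _ d0.
  by rewrite [X in (X < _)%E]M0.
exists U; split => //; first exact: subset_trans MU.
have mU : measurable U by exact: open_measurable.
rewrite -(setDUK MU) measureU //; last 2 first.
- exact: measurableD.
- by rewrite setDIK.
by rewrite [X in (X + _)%E]M0 add0e.
Qed.

(** By Cousin's lemma [a, b] is cut into pieces of two kinds: pieces around a
    point of differentiability, where f increases by at most e1 times the
    length, and pieces contained in an open set U of small measure covering the
    exceptional null set, where absolute continuity bounds the total
    variation. *)
Lemma ac_ae_le0 (f : R -> R) (a b : R) : a <= b -> ac_on a b f ->
  {ae mu, forall t, t \in `[a, b] -> exists2 v : R, v <= 0 & is_derive t 1 f v} ->
  f b <= f a.
Proof.
move=> ab acf [N [mN N0 NP]].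
apply/ler_addgt0Pr => e e0.
pose e1 := e / (2 * (b - a + 1)).
have ba0 : 0 < b - a + 1 by lra.
have e10 : 0 < e1 by rewrite /e1 divr_gt0// mulr_gt0.
have [d d0 Hd] := acf (e / 2) ltac:(lra).
have [|U [oU NU Ud]] := @negligible_open_cover N d _ d0; first by exists N; split.
have mU : measurable U by exact: open_measurable.
(* The list l records the pieces of the second kind inside [x, y]; the
   bound by mu (U `&` `]x, y]) is additive and keeps their total length
   under control. *)
pose Q x y := exists l : seq (R * R),
  [/\ all (fun i => [&& x <= i.1, i.1 <= i.2 & i.2 <= y]) l,
      pairwise (fun i j => i.2 <= j.1) l,
      ((\sum_(i <- l) (i.2 - i.1))%:E <= mu (U `&` `]x, y]))%E &
      f y - f x <= e1 * (y - x) + \sum_(i <- l) `|f i.2 - f i.1|].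
suff [l [Hl Hp Hm Hf]] : Q a b.
  rewrite addrC -lerBlDr; apply: le_trans Hf _.
  have : \sum_(i <- l) `|f i.2 - f i.1| < e / 2.
    rewrite (big_nth (0, 0)) big_mkord.
    apply: (Hd _ (fun i : 'I_(size l) => (nth (0,0) l i).1)
      (fun i : 'I_(size l) => (nth (0,0) l i).2)).
    - move=> i; have /allP := Hl; move=> /(_ _ (mem_nth (0,0) (ltn_ord i))).
      by case/and3P.
    - have lt_disj (i j : 'I_(size l)) : (i < j)%N ->
        `](nth (0,0) l i).1, (nth (0,0) l i).2[%classic `&` `](nth (0,0) l j).1, (nth (0,0) l j).2[%classic !=set0 -> False.
        move=> ij [z []] /=; rewrite !in_itv /= => /andP[_ zi] /andP[jz _].
        have /(pairwiseP (0,0)) := Hp; move=> /(_ i j).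
        rewrite !inE !ltn_ord ij => /(_ erefl erefl erefl).
        by move=> h; have := lt_trans (lt_le_trans zi h) jz; rewrite ltxx.
      move=> i j _ _ H; case: (ltngtP i j) => // ij.
      + by case: (lt_disj _ _ ij H).
      + by rewrite setIC in H; case: (lt_disj _ _ ij H).
      + exact: val_inj.
    - move: Hm; rewrite (big_nth (0, 0)) big_mkord. rewrite -lte_fin => /le_lt_trans; apply.
      apply: le_lt_trans Ud; apply: le_measure; rewrite ?inE//; first exact: measurableI.
  have : e1 * (b - a) <= e / 2.
    rewrite /e1 invfM mulrA -[leRHS]mulr1 -mulrA ler_wpM2l//; first lra.
    by rewrite ler_pdivrMl// mulr1; lra.
  lra.
apply: cousin => //.
- move=> x y z ax xy yz zb [l [Hl Hp Hm Hf]] [k [Kl Kp Km Kf]].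
  exists (l ++ k); split.
  + rewrite all_cat; apply/andP; split.
    * by apply: sub_all Hl => i /and3P[-> -> /= /le_trans->].
    * by apply: sub_all Kl => i /and3P[h -> ->]; rewrite (le_trans xy h).
  + rewrite pairwise_cat Hp Kp !andbT; apply/allrelP => i j il jk.
    have /allP /(_ _ il) /and3P[_ _ h1] := Hl.
    have /allP /(_ _ jk) /and3P[h2 _ _] := Kl.
    exact: le_trans h1 h2.
  + rewrite big_cat EFinD /=.
    have -> : U `&` `]x, z] = (U `&` `]x, y]) `|` (U `&` `]y, z]).
      by rewrite -setIUr -itv_bndbnd_setU// bnd_simp.
    rewrite measureU; [exact: leeD | exact: measurableI | exact: measurableI |].
    apply/seteqP; split => // w [[_ /=]]; rewrite !in_itv /= => /andP[_ h1] [_] /andP[h2 _].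
    by have := le_lt_trans h1 h2; rewrite ltxx.
  + rewrite big_cat /=.
    have -> : f z - f x = (f y - f x) + (f z - f y) by ring.
    have -> : e1 * (z - x) = e1 * (y - x) + e1 * (z - y) by ring.
    lra.
- move=> t /andP[at_ tb].
  have [tN|tN] := pselect (N t).
    have [r /= r0 rU] := open_subball oU (NU _ tN).
    exists (r / 2) => [|p q ap pt tq qb tp qt]; first lra.
    have pqU : `[p, q] `<=` U.
      move=> w /=; rewrite in_itv /= => /andP[pw wq].
      have r20 : 0 < r / 2 by lra.
      apply: (rU (r / 2) _ r20); first by rewrite /ball_ /= sub0r normrN gtr0_norm//; lra.
      by rewrite -ball_normE /ball_ /= ltr_norml; apply/andP; split; lra.
    exists [:: (p, q)]; split => //=.
    + by rewrite !lexx (le_trans pt tq).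
    + rewrite big_seq1 /=.
      have -> : U `&` `]p, q] = `]p, q]%classic.
        apply/setIidPr; apply: subset_trans pqU; exact: subset_itv_oc_cc.
      have := le_trans pt tq; rewrite le_eqVlt => /orP[/eqP->|pq]; first by rewrite subrr measure_ge0.
      by rewrite lebesgue_measure_itv /= lte_fin pq EFinB.
    + by rewrite big_seq1 /= ler_wpDl ?ler_norm// mulr_ge0 ?subr_ge0 ?(le_trans pt tq)// ltW.
  have [v v0 fv] : exists2 v : R, v <= 0 & is_derive t 1 f v.
    apply: contrapT => H; apply: tN; apply: NP => /= K; apply: H; apply: K.
    by rewrite in_itv /= at_ tb.
  have [r r0 Hr] := is_derive_expansion fv e10.
  exists r => // p q ap pt tq qb tp qt.
  exists [::]; split => //=; first by rewrite big_nil measure_ge0.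
  rewrite big_nil addr0.
  have := Hr q; rewrite ger0_norm ?subr_ge0// ltrBlDl => /(_ qt); rewrite ler_norml => /andP[_ h1].
  have := Hr p; rewrite ler0_norm ?subr_le0// opprB ltrBlDr -ltrBlDl => /(_ _) h2'.
  have h2 := h2' ltac:(lra); move: h2; rewrite ler_norml => /andP[h2 _].
  have h3 : (q - t) * v <= 0 by rewrite mulr_ge0_le0// subr_ge0.
  have h4 : (t - p) * v <= 0 by rewrite mulr_ge0_le0// subr_ge0.
  move: h1 h2; rewrite /GRing.scale /= => h1 h2.
  have -> : e1 * (q - p) = e1 * (q - t) + e1 * (t - p) by ring.
  have h5 : (p - t) * v = - ((t - p) * v) by ring.
  lra.
Qed.
End ac.

Section ac_int.
Context {R : realType}.
Local Notation mu := (@lebesgue_measure R).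

Lemma integrable_sub (w : R -> R) (A : set R) : measurable A ->
  mu.-integrable setT (EFin \o w) -> mu.-integrable A (EFin \o w).
Proof. by move=> mA; apply: integrableS. Qed.

Lemma Rintegral_itv_split (w : R -> R) (x y z : R) :
  mu.-integrable setT (EFin \o w) -> x <= y -> y <= z ->
  \int[mu]_(t in `[x, z]) w t = \int[mu]_(t in `[x, y]) w t + \int[mu]_(t in `[y, z]) w t.
Proof.
move=> iw xy yz.
have -> : `[x, z]%classic = `[x, y] `|` `]y, z] by rewrite -itv_bndbnd_setU// bnd_simp.
rewrite Rintegral_setU//.
- congr (_ + _); apply: Rintegral_itv_obnd_cbnd; exact: integrable_sub.
- by apply: integrable_sub => //; exact: measurableU.
- apply/disj_set2P/seteqP; split => // t [/=]; rewrite !in_itv /= => /andP[_ ty] /andP[yt _].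
  by have := lt_le_trans yt ty; rewrite ltxx.
Qed.

(** Absolute continuity of the integral, read through the increments. *)
Lemma ac_of_integral_bound {V : normedModType R} (f : R -> V) (w : R -> R) (a b : R) :
  mu.-integrable setT (EFin \o w) ->
  (forall s t, a <= s -> s <= t -> t <= b -> `|f t - f s| <= \int[mu]_(x in `[s, t]) `|w x|) ->
  ac_on a b f.
Proof.
move=> iw Hf e e0.
have [d [d0 Hd]] := integral_normr_continuous iw e0.
exists d => // N p q Hpq tI sd.
apply: le_lt_trans (ler_sum _ _) _.
  by move=> i _; have [h1 [h2 h3]] := Hpq i; apply: Hf h1 h2 h3.
have iaw : mu.-integrable setT (EFin \o (fun x => `|w x|)).
  by rewrite (_ : _ \o _ = abse \o (EFin \o w))//; exact: integrable_abse.
pose A := \big[setU/set0]_(i <- index_enum 'I_N) `]p i, q i[%classic.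
have mA : measurable A by apply: bigsetU_measurable.
have tI' : trivIset [set` index_enum 'I_N] (fun i => `]p i, q i[%classic).
  by move=> i j _ _; apply: tI.
have muA : mu A = (\sum_(i < N) (q i - p i))%:E.
  rewrite measure_bigsetU_ord//.
  rewrite -sumEFin; apply: eq_bigr => i _.
  have [_ [+ _]] := Hpq i; rewrite le_eqVlt => /orP[/eqP->|pq].
    by rewrite set_itvoo0 measure0 subrr.
  by apply: (etrans (lebesgue_measure_itv _)); rewrite /= lte_fin pq EFinB.
have muAd : (mu A < d%:E)%E by rewrite muA lte_fin.
apply: le_lt_trans (Hd A mA muAd).
rewrite -lee_fin -sumEFin /Rintegral fineK; last exact/integrable_fin_num/integrable_sub.
rewrite ge0_integral_bigsetU//; last 2 first.
- exact: index_enum_uniq.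
- by apply: measurable_funTS; have /integrableP[] := iaw.
apply: lee_sum => i _.
rewrite fineK; last exact/integrable_fin_num/integrable_sub.
rewrite -integral_itv_bndo_bndc// -?integral_itv_obnd_cbnd//.
- by apply: measurable_funTS; have /integrableP[] := iaw.
- by apply: measurable_funTS; have /integrableP[] := iaw.
Qed.

Lemma ac_onB {V : normedModType R} (a b : R) (f g : R -> V) :
  ac_on a b f -> ac_on a b g -> ac_on a b (fun x => f x - g x).
Proof.
move=> af ag e e0.
have [d1 d10 H1] := af (e / 2) ltac:(lra).
have [d2 d20 H2] := ag (e / 2) ltac:(lra).
exists (Num.min d1 d2); first by rewrite lt_min d10.
move=> N p q Hpq tI; rewrite lt_min => /andP[h1 h2].
apply: le_lt_trans (_ : \sum_(i < N) (`|f (q i) - f (p i)| + `|g (q i) - g (p i)|) < _).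
  apply: ler_sum => i _; rewrite opprB [X in _ + X]addrC addrACA [X in _ + X]addrC.
  by rewrite -[g (p i) - g (q i)]opprB ler_normB.
by rewrite big_split /= [ltRHS]splitr; apply: ltrD; [exact: H1|exact: H2].
Qed.

(** Subtract from f the primitive of phi, which has derivative phi almost
    everywhere by Lebesgue differentiation. *)
Lemma ac_ae_le (f phi : R -> R) (a b : R) : a <= b -> ac_on a b f ->
  mu.-integrable setT (EFin \o phi) ->
  {ae mu, forall t, t \in `[a, b] -> exists2 v : R, v <= phi t & is_derive t 1 f v} ->
  f b - f a <= \int[mu]_(t in `[a, b]) phi t.
Proof.
move=> ab acf iphi fphi.
pose F x := \int[mu]_(t in `[a, x]) phi t.
have iphiA A : measurable A -> mu.-integrable A (EFin \o phi) by move=> mA; exact: integrable_sub.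
have Fac : ac_on a b F.
  apply: (@ac_of_integral_bound _ F phi) => // s t as_ st tb.
  rewrite /F (@Rintegral_itv_split phi a s t)// addrC addKr.
  by apply: le_normr_Rintegral => //; exact: iphiA.
have Fder : {ae mu, forall x, (a%:E < x%:E)%E -> derivable F x 1 /\ derive1 F x = phi x}.
  apply: (@FTC1 R phi (BLeft a)) => [y|]; first exact: iphiA.
  by apply: open_integrable_locally => //; exact: openT.
have : f b - F b <= f a - F a.
  apply: (@ac_ae_le0 _ (fun x => f x - F x)) => //; first exact: ac_onB.
  (* Lebesgue differentiation of the primitive says nothing at the end a. *)
  have aN : {ae mu, forall t, t != a}.
    exists [set a]; split => //; first exact: lebesgue_measure_set1.
    by move=> t /= /negP; rewrite negbK => /eqP.
  move: fphi Fder aN; apply: (@filterS3 _ _ (ae_filter_ringOfSetsType mu)) => t Hf HF ta tab.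
  have [v vphi fv] := Hf tab.
  have [|dF F'] := HF.
    by move: tab; rewrite in_itv /= lte_fin lt_neqAle eq_sym ta => /andP[].
  exists (v - phi t); first by rewrite subr_le0.
  have Fphi : is_derive t 1 F (phi t) by rewrite -F' derive1E; exact: derivableP.
  exact: (@is_deriveB _ _ _ f F t 1 v (phi t) fv Fphi).
have -> : F a = 0 by rewrite /F set_itv1 Rintegral_set1.
rewrite subr0 /F; lra.
Qed.

End ac_int.

(** * Affine changes of variables and coordinates *)

Section affine.
Context {R : realType}.
Local Notation mu := (@lebesgue_measure R).
Variables (al be : R).
Hypothesis al0 : al != 0.
Let phi : R -> R := fun t => al * t + be.

Let mphi : measurable_fun [set: measurableTypeR R] (phi : _ -> measurableTypeR R).
Proof.
apply: continuous_measurable_fun => x; apply: cvgD; last exact: cvg_cst.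
by apply: cvgM; [exact: cvg_cst | exact: cvg_id].
Qed.

Let nal : {nonneg R} := NngNum (normr_ge0 al).

(** Uniqueness of Lebesgue measure: the rescaled image measure gives intervals
    the right length. *)
Lemma lebesgue_measure_affine (A : set R) : measurable A ->
  mu A = (`|al|%:E * mu ((fun t => (al * t + be)%R) @^-1` A))%E.
Proof.
move=> mA.
apply: (@lebesgue_measure_unique R (mscale nal (pushforward mu (phi : measurableTypeR R -> measurableTypeR R)))) => // _ [[a b]] _ <-.
change (mu `]a, b]%classic = (`|al|%:E * mu (phi @^-1` `]a, b]%classic))%E).
have invphi z : phi ((z - be) / al) = z by rewrite /phi mulrCA mulfV// mulr1 subrK.
case: (ltgtP al 0) al0 => // als _.
- have -> : phi @^-1` `]a, b] = `[(b - be) / al, (a - be) / al[%classic.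
    apply/seteqP; split => t /=; rewrite !in_itv /= /phi ler_ndivrMr// ltr_ndivlMr// [t * al]mulrC; lra.
  rewrite !lebesgue_measure_itv /= !lte_fin ltr_nM2r ?invr_lt0// ltrD2r.
  case: ifPn => _; last by rewrite mule0.
  rewrite ltr0_norm// -!EFinB -EFinM; congr (_%:E).
  by rewrite mulNr mulrBr ![al * (_ / _)]mulrCA mulfV// !mulr1; ring.
- have -> : phi @^-1` `]a, b] = `](a - be) / al, (b - be) / al]%classic.
    apply/seteqP; split => t /=; rewrite !in_itv /= /phi ler_pdivlMr// ltr_pdivrMr// [t * al]mulrC; lra.
  rewrite !lebesgue_measure_itv /= !lte_fin ltr_pM2r ?invr_gt0// ltrD2r.
  case: ifPn => _; last by rewrite mule0.
  rewrite gtr0_norm// -!EFinB -EFinM; congr (_%:E).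
  by rewrite mulrBr ![al * (_ / _)]mulrCA mulfV// !mulr1; ring.
Qed.

Lemma measurable_affine_preimage (A : set R) : measurable A ->
  measurable ((fun t => al * t + be) @^-1` A).
Proof. by move=> mA; rewrite -[X in measurable X]setTI; exact: mphi. Qed.

Lemma measurable_fun_affine_comp d (T : measurableType d) (D : set R) (f : R -> T) :
  measurable D -> measurable_fun D f ->
  measurable_fun ((fun t => al * t + be) @^-1` D) (fun t => f (al * t + be)).
Proof.
move=> mD mf; apply: (measurable_comp mD _ mf) => [x [t Dt <-]//|].
exact: (measurable_funTS mphi).
Qed.

Lemma ge0_integral_affine (D : set R) (f : R -> \bar R) :
  measurable D -> measurable_fun D f -> (forall x, D x -> 0 <= f x)%E ->
  (\int[mu]_(t in D) f t =
   `|al|%:E * \int[mu]_(t in (fun t => (al * t + be)%R) @^-1` D) f (al * t + be)%R)%E.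
Proof.
move=> mD mf f0.
rewrite [X in (_ * X)%E](_ : _ = (\int[pushforward mu (phi : measurableTypeR R -> measurableTypeR R)]_(y in D) f y)%E); last first.
  by rewrite ge0_integral_pushforward// => y /[!inE]; exact: f0.
rewrite -[RHS](@ge0_integral_mscale _ _ _ _ _ _ nal)//.
by apply: eq_measure_integral => A mA _; exact: lebesgue_measure_affine.
Qed.

Lemma negligible_affine (N : set R) : mu.-negligible N ->
  mu.-negligible ((fun t => al * t + be) @^-1` N).
Proof.
move=> [M [mM M0 NM]]; exists ((fun t => al * t + be) @^-1` M); split.
- exact: measurable_affine_preimage.
- move: M0; rewrite (lebesgue_measure_affine mM) => /eqP.
  by rewrite mule_eq0 eqe normr_eq0 (negbTE al0) /= => /eqP.
- by move=> t /= /NM.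
Qed.

End affine.

Section coord.
Context {R : realType} {n : nat}.

Lemma normr_coord (x : 'rV[R]_n) (j : 'I_n) : `|x 0 j| <= `|x|.
Proof.
rewrite [leRHS]mx_normrE.
by apply: (le_bigmax _ (fun ij : 'I_1 * 'I_n => `|x ij.1 ij.2|) (0, j)).
Qed.

Lemma normr_le_coord (x : 'rV[R]_n) (c : R) : 0 <= c -> (forall j, `|x 0 j| <= c) -> `|x| <= c.
Proof.
move=> c0 H; rewrite [leLHS]mx_normrE; apply: bigmax_le => // [[i j]] _ /=.
by rewrite ord1.
Qed.

Lemma is_derive_coord (g : R -> 'rV[R]_n) (t : R) (v : 'rV[R]_n) (j : 'I_n) : is_derive t 1 g v ->
  is_derive t 1 (fun s => g s 0 j) (v 0 j).
Proof.
move=> gv; apply: expansion_is_derive => e e0.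
have [d d0 H] := is_derive_expansion gv e0.
exists d => // s st; apply: le_trans (H s st).
apply: le_trans (normr_coord _ j).
by rewrite !mxE.
Qed.
End coord.

(** * Horizontal curves and the Carnot-Caratheodory distance *)

Section horizontal_curves.
Context {R : realType} {n s : nat} (G : carnotGroup R n s).
Local Notation mu := (@lebesgue_measure R).
Local Notation E := 'rV[R]_n.
Local Notation X := (left_inv_field (cmul G)).

Definition speed (u : 'I_n -> R -> R) (t : R) : R :=
  Num.sqrt (\sum_(i < n | cdeg G i == 1%N) u i t ^+ 2).

Lemma speed_ge0 u t : 0 <= speed u t. Proof. exact: sqrtr_ge0. Qed.

Lemma control_le_speed u t i : cdeg G i = 1%N -> `|u i t| <= speed u t.
Proof.
move=> i1; rewrite -sqrtr_sqr ler_wsqrtr// (bigD1 i) ?i1//= lerDl.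
by apply: sumr_ge0 => j _; exact: sqr_ge0.
Qed.

Lemma speed_le_sum u t : speed u t <= \sum_(i < n | cdeg G i == 1%N) `|u i t|.
Proof.
rewrite -[leRHS]ger0_norm ?sumr_ge0// -sqrtr_sqr ler_wsqrtr//.
pose P (i : 'I_n) := cdeg G i == 1%N; rewrite -/P.
have H : forall l : seq 'I_n, \sum_(i <- l | P i) u i t ^+ 2 <= (\sum_(i <- l | P i) `|u i t|) ^+ 2.
  elim=> [|i l IH]; first by rewrite !big_nil expr0n.
  rewrite !big_cons; case: ifP => // _.
  rewrite sqrrD real_normK ?num_real// -addrA lerD2l ler_wpDl//.
  by rewrite mulrn_wge0// mulr_ge0// sumr_ge0.
exact: H.
Qed.

Lemma measurable_speed (D : set R) u : measurable D ->
  (forall i, cdeg G i = 1%N -> measurable_fun D (u i)) ->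
  measurable_fun D (speed u).
Proof.
move=> mD mu_; rewrite (_ : speed u = Num.sqrt \o (fun t => \sum_(i < n) if cdeg G i == 1%N then u i t ^+ 2 else 0)); last first.
  by apply/funext => t; rewrite /speed /= big_mkcond.
apply: measurableT_comp.
  by apply: continuous_measurable_fun; exact: sqrt_continuous.
apply: measurable_sum => i; case: (cdeg G i =P 1%N) => [i1|_]; last exact: measurable_cst.
by apply: measurable_funX; exact: mu_.
Qed.

Lemma speed_integrable (D : set R) u : measurable D ->
  (forall i, cdeg G i = 1%N -> mu.-integrable D (EFin \o u i)) ->
  mu.-integrable D (EFin \o speed u).
Proof.
move=> mD iu.
have isum : mu.-integrable D (fun t => \sum_(i < n) (if cdeg G i == 1%N then `|u i t|%:E else 0%:E))%E.
  apply: integrable_sum => // i _; case: (cdeg G i =P 1%N) => [i1|_]; last exact: integrable0.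
  by apply: (integrable_abse (iu _ i1)).
apply: le_integrable isum => //.
  apply/measurable_EFinP; apply: measurable_speed => // i i1.
  by have /integrableP[/measurable_EFinP] := iu _ i1.
move=> t _ /=; rewrite (ger0_norm (speed_ge0 _ _)).
have -> : (\sum_(i < n) (if cdeg G i == 1%N then `|u i t|%:E else 0%:E))%E = (\sum_(i < n | cdeg G i == 1%N) `|u i t|)%:E.
  rewrite [in RHS]big_mkcond/= -sumEFin; apply: eq_bigr => i _; by case: ifP.
by rewrite lee_fin ger0_norm ?sumr_ge0// speed_le_sum.
Qed.

Lemma horizontal_speed_integrable a b g u : horizontal G a b g u ->
  mu.-integrable `[a, b] (EFin \o speed u).
Proof. by case=> _ iu _; exact: speed_integrable. Qed.

(** Cutting the speed off outside [a, b] makes it integrable on the whole line,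
    so that its integrals over subintervals need no further hypothesis. *)
Definition cspeed a b u : R -> R := speed u \_ `[a, b].

Lemma cspeed_integrable a b g u : horizontal G a b g u ->
  mu.-integrable setT (EFin \o cspeed a b u).
Proof.
move=> /horizontal_speed_integrable; rewrite integrable_mkcond//.
by rewrite restrict_EFin.
Qed.

Lemma cspeed_ge0 a b u t : 0 <= cspeed a b u t.
Proof. by rewrite /cspeed patchE; case: ifP => // _; exact: speed_ge0. Qed.

Lemma hlengthE a b g u : horizontal G a b g u ->
  hlength G a b u = (\int[mu]_(t in `[a, b]) cspeed a b u t)%:E.
Proof.
move=> hg; rewrite /hlength /Rintegral fineK; last first.
  by apply: integrable_fin_num => //; apply: integrable_sub => //; exact: cspeed_integrable hg.
by apply: eq_integral => t tab; rewrite /= /cspeed patchE tab.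
Qed.

Lemma ac_on_sub {V : normedModType R} (f : R -> V) (a b a' b' : R) : a <= a' -> b' <= b ->
  ac_on a b f -> ac_on a' b' f.
Proof.
move=> aa bb H e e0; have [d d0 Hd] := H e e0; exists d => // N p q Hpq; apply: Hd => i.
have [h1 [h2 h3]] := Hpq i; split; first exact: le_trans aa h1.
by split => //; exact: le_trans h3 bb.
Qed.

Lemma ac_on_coord (g : R -> E) (a b : R) (j : 'I_n) : ac_on a b g -> ac_on a b (fun t => g t 0 j).
Proof.
move=> H e e0; have [d d0 Hd] := H e e0; exists d => // N p q h1 h2 h3.
apply: le_lt_trans (Hd N p q h1 h2 h3); apply: ler_sum => i _.
by apply: le_trans (normr_coord _ j); rewrite !mxE.
Qed.

Lemma ac_onN (f : R -> R) (a b : R) : ac_on a b f -> ac_on a b (fun t => - f t).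
Proof.
move=> H e e0; have [d d0 Hd] := H e e0; exists d => // N p q h1 h2 h3.
by under eq_bigr do rewrite opprK addrC distrC; exact: Hd.
Qed.

Lemma ac_on_uniform {V : normedModType R} (f : R -> V) (a b : R) : ac_on a b f ->
  forall e : R, 0 < e -> exists2 d : R, 0 < d & forall s t, a <= s -> s <= t -> t <= b ->
    t - s < d -> `|f t - f s| < e.
Proof.
move=> H e e0; have [d d0 Hd] := H e e0; exists d => // x y ax xy yb xyd.
have := Hd 1%N (fun=> x) (fun=> y); rewrite !big_ord1; apply => //.
by move=> i j _ _ _; rewrite !ord1.
Qed.

Variables (rho K : R).
Hypothesis K0 : 0 < K.
Hypothesis XK : forall x : E, `|x| <= rho -> forall i, `|X i x| <= K.

(** Each coordinate of g, with either sign, has derivative at most n K times the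
    speed wherever the curve has a derivative and stays where the fields are
    bounded by K. *)
Lemma horizontal_increment a b g u x y : horizontal G a b g u ->
  (forall t, x <= t <= y -> `|g t| <= rho) -> a <= x -> x <= y -> y <= b ->
  `|g y - g x| <= \int[mu]_(t in `[x, y]) (n%:R * K * cspeed a b u t).
Proof.
move=> hg gin ax xy yb.
have iw : mu.-integrable setT (EFin \o (fun t => n%:R * K * cspeed a b u t)).
  exact: (integrableZl measurableT (n%:R * K) (cspeed_integrable hg)).
have [acg _ gder] := hg.
have dbound (t : R) (v : E) : is_derive t 1 g v -> t \in `[x, y] ->
    v = \sum_(i < n | cdeg G i == 1%N) u i t *: X i (g t) -> forall j,
   `|v 0 j| <= n%:R * K * cspeed a b u t.
  move=> gv txy -> j; apply: le_trans (normr_coord _ _) _.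
  have tab : a <= t <= b.
    by move: txy; rewrite in_itv /= => /andP[xt ty]; rewrite (le_trans ax xt) (le_trans ty yb).
  have -> : cspeed a b u t = speed u t by rewrite /cspeed patchE mem_set//= in_itv.
  apply: le_trans (ler_norm_sum _ _ _) _.
  apply: (@le_trans _ _ (\sum_(i < n) K * speed u t)).
    rewrite big_mkcond /=; apply: ler_sum => i _; case: ifPn => [/eqP i1|_].
      rewrite normrZ mulrC ler_pM//; [by apply: XK; apply: gin; move: txy; rewrite in_itv | exact: control_le_speed].
    by rewrite mulr_ge0 ?speed_ge0 ?(ltW K0).
  by rewrite sumr_const card_ord -[leLHS]mulr_natl mulrA.
have key j (sg : bool) : (-1) ^+ sg * (g y 0 j - g x 0 j) <= \int[mu]_(t in `[x, y]) (n%:R * K * cspeed a b u t).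
  have acj : ac_on x y (fun t => g t 0 j) by apply: ac_on_coord; exact: ac_on_sub acg.
  rewrite mulrBr; apply: (@ac_ae_le _ (fun t => (-1) ^+ sg * g t 0 j)) => //.
    case: sg; last first.
      by rewrite (_ : (fun _ => _) = (fun t => g t 0 j))//; apply/funext => t; rewrite mul1r.
    rewrite (_ : (fun _ => _) = (fun t => - g t 0 j)); first exact: ac_onN.
    by apply/funext => t; rewrite mulN1r.
  move: gder; apply: (@filterS _ _ (ae_filter_ringOfSetsType mu)) => t + txy.
  set v := (\sum_(_ < _ | _) _) => H.
  have tab : t \in `[a, b].
    by move: txy; rewrite !in_itv /= => /andP[xt ty]; rewrite (le_trans ax xt) (le_trans ty yb).
  have gv := H tab.
  exists ((-1) ^+ sg * v 0 j).
    by apply: le_trans (ler_norm _) _; rewrite normrM normrX normrN1 expr1n mul1r (dbound t v).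
  exact: (@is_deriveZ _ _ _ (fun t => g t 0 j) ((-1) ^+ sg) t 1 _ (is_derive_coord j gv)).
apply: normr_le_coord => [|j].
  by apply: Rintegral_ge0 => t _; rewrite !mulr_ge0 ?cspeed_ge0 ?ler0n// ltW.
rewrite !mxE ler_norml; apply/andP; split.
- by have := key j true; rewrite mulN1r lerNl.
- by have := key j false; rewrite mul1r.
Qed.

Lemma horizontal_increment_length a b g u x y : horizontal G a b g u ->
  (forall t, x <= t <= y -> `|g t| <= rho) -> a <= x -> x <= y -> y <= b ->
  `|g y - g x| <= n%:R * K * \int[mu]_(t in `[a, b]) cspeed a b u t.
Proof.
move=> hg gin ax xy yb.
have iw := cspeed_integrable hg.
apply: le_trans (horizontal_increment hg gin ax xy yb) _.
rewrite RintegralZl//; last exact: integrable_sub.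
apply: ler_wpM2l; first by rewrite mulr_ge0// ltW.
rewrite (@Rintegral_itv_split _ _ a x b)// ?(le_trans xy)//.
rewrite (@Rintegral_itv_split _ _ x y b)//.
rewrite addrCA lerDl addr_ge0// Rintegral_ge0// => t _; exact: cspeed_ge0.
Qed.

(** A continuity argument: as long as the curve stays in the ball of radius rho,
    it stays in a ball of radius strictly less than rho. *)
Lemma horizontal_stay a b g u : a <= b -> horizontal G a b g u ->
  `|g a| <= rho / 2 -> n%:R * K * \int[mu]_(t in `[a, b]) cspeed a b u t < rho / 2 ->
  forall t, a <= t <= b -> `|g t| <= rho.
Proof.
move=> ab hg ga Lr.
set L := n%:R * K * _ in Lr.
have [acg _ _] := hg.
(* The margin rho / 2 - L is what the curve may move before the bound on its
   increments has to be applied again. *)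
have [d d0 Hd] := ac_on_uniform acg (e := rho / 2 - L) ltac:(lra).
pose Q (x y : R) := (forall t, a <= t <= x -> `|g t| <= rho) -> (forall t, a <= t <= y -> `|g t| <= rho).
suff : Q a b.
  apply => t; rewrite -eq_le => /eqP <-.
  by have := normr_ge0 (g a); lra.
(* Q x y propagates the bound by rho from [a, x] to [a, y]. *)
apply: cousin => //.
- by move=> x y z _ _ _ _ h1 h2 /h1 /h2.
- move=> t /andP[at_ tb]; exists (d / 2) => [|p q ap pt tq qb tp qt Hp z]; first lra.
  move=> /andP[az zq].
  have [zp|pz] := leP z p; first by apply: Hp; rewrite az zp.
  have h1 : `|g p - g a| <= L.
    by apply: horizontal_increment_length => //; exact: le_trans (le_trans pt tq) qb.
  have h2 : `|g z - g p| < rho / 2 - L.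
    apply: Hd => //; [exact: ltW | exact: le_trans zq qb | lra].
  have -> : g z = (g z - g p) + (g p - g a) + g a by rewrite addrA !subrK.
  have := ler_normD (g z - g p + (g p - g a)) (g a).
  have := ler_normD (g z - g p) (g p - g a).
  lra.
Qed.
End horizontal_curves.

Section reparametrization.
Context {R : realType} {n s : nat} (G : carnotGroup R n s).
Local Notation mu := (@lebesgue_measure R).
Local Notation E := 'rV[R]_n.
Local Notation X := (left_inv_field (cmul G)).

Lemma ac_on_affine {V : normedModType R} (f : R -> V) (al be a b p q : R) : al != 0 ->
  (forall t, (p <= t <= q) = (a <= al * t + be <= b)) ->
  ac_on a b f -> ac_on p q (fun t => f (al * t + be)).
Proof.
move=> al0 Hpq Hf e e0; have [d d0 Hd] := Hf e e0.
have nal0 : 0 < `|al| by rewrite normr_gt0.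
exists (d / `|al|); first by rewrite divr_gt0.
move=> N x y Hxy tI sd.
pose phi t := al * t + be.
pose P i := if 0 < al then phi (x i) else phi (y i).
pose Q i := if 0 < al then phi (y i) else phi (x i).
have -> : \sum_(i < N) `|f (al * y i + be) - f (al * x i + be)| = \sum_(i < N) `|f (Q i) - f (P i)|.
  by apply: eq_bigr => i _; rewrite /Q /P; case: ifP => // _; rewrite distrC.
have QP i : Q i - P i = `|al| * (y i - x i).
  rewrite /Q /P /phi; case: ifPn => [h|]; first by rewrite gtr0_norm//; ring.
  by rewrite -leNgt => h; rewrite ler0_norm//; ring.
apply: Hd.
- move=> i; have [h1 [h2 h3]] := Hxy i.
  have := Hpq (x i); rewrite h1 (le_trans h2 h3) => /esym/andP[u1 u2].
  have := Hpq (y i); rewrite h3 (le_trans h1 h2) => /esym/andP[u3 u4].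
  split; first by rewrite /P; case: ifP.
  split; last by rewrite /Q; case: ifP.
  by rewrite -subr_ge0 QP mulr_ge0// subr_ge0.
- move=> i j _ _ [z [/= zi zj]]; apply: tI => //; exists ((z - be) / al).
  have H k : z \in `]P k, Q k[ -> (z - be) / al \in `]x k, y k[.
    rewrite !in_itv /= /P /Q /phi; case: ifPn => h /andP[z1 z2].
      rewrite ltr_pdivlMr// ltr_pdivrMr// ![_ * al]mulrC; lra.
    have h' : al < 0 by rewrite lt_neqAle al0 leNgt.
    rewrite ltr_ndivlMr// ltr_ndivrMr// ![_ * al]mulrC; lra.
  by split; apply: H.
- under eq_bigr do rewrite QP.
  by rewrite -mulr_sumr mulrC -ltr_pdivlMr.
Qed.

(** A negative factor is allowed: time reversal yields the symmetry of the
    distance. *)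
Lemma horizontal_affine (al be a b p q : R) g u : al != 0 ->
  (forall t, (p <= t <= q) = (a <= al * t + be <= b)) ->
  horizontal G a b g u ->
  let g' := fun t => g (al * t + be) in
  let u' := fun i t => al * u i (al * t + be) in
  horizontal G p q g' u' /\ hlength G p q u' = hlength G a b u.
Proof.
move=> al0 Hpq hg g' u'; have [acg iu gder] := hg.
have pre : (fun t => al * t + be) @^-1` `[a, b] = `[p, q]%classic.
  by apply/seteqP; split => t /=; rewrite !in_itv /= -Hpq.
have mui i : cdeg G i = 1%N -> measurable_fun `[a, b] (u i).
  by move=> i1; have /integrableP[/measurable_EFinP] := iu i i1.
split; [split|].
- exact: ac_on_affine.
- move=> i i1; apply/integrableP; split.
    apply/measurable_EFinP; apply: measurable_funM; first exact: measurable_cst.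
    by rewrite -pre; apply: measurable_fun_affine_comp => //; exact: mui.
  have /integrableP[_ ifin] := iu i i1.
  under eq_integral => t _ do rewrite /= normrM EFinM -[(`|u i _|%:E)%E]/((abse \o EFin \o u i) _).
  rewrite -pre.
  have mF : measurable_fun `[a, b] ((abse \o EFin) \o u i).
    by rewrite -compA; apply: measurableT_comp => //; apply/measurable_EFinP; exact: mui.
  rewrite ge0_integralZl//; last 3 first.
  + exact: measurable_affine_preimage.
  + exact: (@measurable_fun_affine_comp _ al be _ _ _ ((abse \o EFin) \o u i)).
  + by move=> t _ /=.
  by rewrite -ge0_integral_affine// => t _ /=.
- have [N [mN N0 NP]] := gder.
  have [M [mM M0 NM]] : mu.-negligible ((fun t => al * t + be) @^-1` N).
    by apply: negligible_affine => //; exists N; split.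
  exists M; split => //; apply: subset_trans NM => t /= Ht; apply: NP => /= K; apply: Ht => tpq.
  have := K _; rewrite in_itv /= -Hpq => /(_ tpq) gd.
  rewrite (_ : \sum_(i < n | _) _ = al *: \sum_(i < n | cdeg G i == 1%N) u i (al * t + be) *: X i (g (al * t + be))); last first.
    by rewrite scaler_sumr; apply: eq_bigr => i _; rewrite scalerA.
  apply: expansion_is_derive => e e0.
  have nal0 : 0 < `|al| by rewrite normr_gt0.
  have [d d0 Hd] := is_derive_expansion gd (divr_gt0 e0 nal0).
  have E1 z : al * z + be - (al * t + be) = al * (z - t) by ring.
  exists (d / `|al|); first by rewrite divr_gt0.
  move=> z zt; have := Hd (al * z + be); rewrite E1 normrM => /(_ _)/=.
  rewrite scalerA [(z - t) * al]mulrC mulrA divfK ?gt_eqF//; apply.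
  by rewrite mulrC -ltr_pdivlMr.
- have mS : measurable_fun `[a, b] (EFin \o speed G u).
    by apply/measurable_EFinP; exact: measurable_speed.
  have S0 t : `[a, b]%classic t -> (0%R <= (EFin \o speed G u) t)%E.
    by rewrite lee_fin sqrtr_ge0.
  have := @ge0_integral_affine R al be al0 `[a, b] (EFin \o speed G u) (measurable_itv _) mS S0.
  rewrite /hlength => ->.
  rewrite -ge0_integralZl//; last 3 first.
  + exact: measurable_affine_preimage.
  + exact: (@measurable_fun_affine_comp _ al be _ _ _ (EFin \o speed G u)).
  + by move=> t _; rewrite lee_fin sqrtr_ge0.
  rewrite pre; apply: eq_integral => t _; rewrite -EFinM; congr (_%:E).
  rewrite -sqrtr_sqr -sqrtrM ?sqr_ge0// mulr_sumr; congr Num.sqrt.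
  by apply: eq_bigr => i _; rewrite exprMn.
Qed.

Lemma cc_dist_ltP x y (r : R) : (cc_dist G x y < r%:E)%E ->
  exists g u, [/\ horizontal G 0 1 g u, g 0 = x, g 1 = y & (hlength G 0 1 u < r%:E)%E].
Proof.
by move=> /ereal_inf_lt[_ [g [u [h1 h2 h3 ->]]] h]; exists g, u.
Qed.

Lemma cc_dist_le_hlength g u : horizontal G 0 1 g u -> (cc_dist G (g 0%R) (g 1%R) <= hlength G 0 1 u)%E.
Proof. by move=> hg; apply: ereal_inf_lbound; exists g, u. Qed.

Lemma cc_dist_sym_le x y : (cc_dist G y x <= cc_dist G x y)%E.
Proof.
apply: le_ereal_inf_tmp => _ [g [u [hg g0 g1 ->]]].
have [||hg' <-] := @horizontal_affine (-1) 1 0 1 0 1 g u _ _ hg.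
- by rewrite oppr_eq0 oner_eq0.
- by move=> t; rewrite mulN1r; apply/idP/idP; lra.
have := cc_dist_le_hlength hg'.
by rewrite /= mulr0 add0r mulr1 addNr g0 g1.
Qed.

Lemma cc_distC x y : cc_dist G x y = cc_dist G y x.
Proof. by apply/eqP; rewrite eq_le !cc_dist_sym_le. Qed.

End reparametrization.

Section local_bound.
Context {R : realType} {n s : nat} (G : carnotGroup R n s).
Local Notation mu := (@lebesgue_measure R).
Local Notation E := 'rV[R]_n.
Local Notation X := (left_inv_field (cmul G)).
Variables (rho K : R).
Hypothesis K0 : 0 < K.
Hypothesis XK : forall x : E, `|x| <= rho -> forall i, `|X i x| <= K.

(** A nearly optimal curve is too short to leave the ball where the fields are
    bounded. *)
Lemma norm_le_cc_dist x y (r : R) : `|x| <= rho / 2 -> (n%:R * K) * r <= rho / 2 ->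
  (cc_dist G x y < r%:E)%E -> `|y - x| <= n%:R * K * r.
Proof.
move=> xr rr /cc_dist_ltP[g [u [hg g0 g1]]].
rewrite (hlengthE hg) lte_fin.
set L := \int[mu]_(_ in _) _ => Lr.
have [n0|n0] := posnP n.
  have -> : y - x = 0 by apply/rowP => i; exfalso; move: (ltn_ord i); rewrite [X in (_ < X)%N]n0.
  by rewrite normr0 [X in X%:R]n0 !mul0r.
have Lr' : n%:R * K * L < n%:R * K * r by rewrite ltr_pM2l// mulr_gt0// ltr0n.
have stay := @horizontal_stay _ _ _ G rho K K0 XK 0 1 g u ler01 hg.
have := horizontal_increment_length K0 XK hg (x := 0) (y := 1) _ (lexx 0) ler01 (lexx 1).
rewrite g0 g1 -/L => H; apply: le_trans (H _) (ltW Lr').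
apply: stay; first by rewrite g0.
exact: lt_le_trans Lr' rr.
Qed.

End local_bound.

(** * Concatenation of curves, completeness and triangle inequality *)

(** Infinitely many horizontal curves run one after the other, on consecutive
    intervals [T k, T k.+1] exhausting [0, 1[, with finite total length. *)
Section glue.
Context {R : realType} {n s : nat} (G : carnotGroup R n s).
Local Notation mu := (@lebesgue_measure R).
Local Notation E := 'rV[R]_n.
Local Notation X := (left_inv_field (cmul G)).
Variables (rho K : R).
Hypothesis K0 : 0 < K.
Hypothesis XK : forall x : E, `|x| <= rho -> forall i, `|X i x| <= K.

Variable T : nat -> R.
Hypothesis T0 : T 0%N = 0.
Hypothesis Tincr : forall k, T k < T k.+1.
Hypothesis Tlt1 : forall k, T k < 1.
Hypothesis Tcvg : forall t, t < 1 -> exists k, t < T k.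
Variables (g : nat -> R -> E) (u : nat -> 'I_n -> R -> R) (L : R).
Hypothesis hg : forall k, horizontal G (T k) (T k.+1) (g k) (u k).
Hypothesis gg : forall k, g k (T k.+1) = g k.+1 (T k.+1).
Hypothesis grho : forall k t, T k <= t <= T k.+1 -> `|g k t| <= rho.
Hypothesis Llen : (\sum_(k <oo) hlength G (T k) (T k.+1) (u k) <= L%:E)%E.

Let Tle j k : (j <= k)%N -> T j <= T k.
Proof. by move=> jk; apply: (homo_leq (r := fun x y => x <= y)) jk => // [y x z|i]; [exact: le_trans|exact/ltW]. Qed.

Let Tge0 k : 0 <= T k. Proof. by rewrite -T0 Tle. Qed.

Let idx (t : R) : nat := xget 0%N [set k | T k <= t < T k.+1].

Let idxP t k : T k <= t < T k.+1 -> idx t = k.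
Proof.
move=> tk; apply: xget_unique => // j /andP[j1 j2].
case/andP: tk => k1 k2; apply/eqP; rewrite eqn_leq; apply/andP; split; rewrite leqNgt; apply/negP => h.
- by have := lt_le_trans k2 (le_trans (Tle h) j1); rewrite ltxx.
- by have := lt_le_trans j2 (le_trans (Tle h) k1); rewrite ltxx.
Qed.

Let idx_ex t : 0 <= t -> t < 1 -> exists k, T k <= t < T k.+1.
Proof.
move=> t0 t1; have [m tm] := Tcvg t1.
elim: m tm => [|m IH tm]; first by rewrite T0 ltNge t0.
by have [/IH//|h] := ltP t (T m); exists m; rewrite h tm.
Qed.

Let x k := g k (T k).
Let ell k := \int[mu]_(t in `[T k, T k.+1]) cspeed G (T k) (T k.+1) (u k) t.

Let ell_ge0 k : 0 <= ell k.
Proof. by apply: Rintegral_ge0 => t _; exact: cspeed_ge0. Qed.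

Let ellE k : hlength G (T k) (T k.+1) (u k) = (ell k)%:E.
Proof. exact: hlengthE (hg k). Qed.

Let xincr k : `|x k.+1 - x k| <= n%:R * K * ell k.
Proof.
rewrite /x -gg; apply: (@horizontal_increment_length _ _ _ G rho K K0 XK _ _ _ _ _ _ (hg k)) => //.
- by move=> t; exact: grho.
- exact/ltW.
Qed.

Let nK0 : 0 <= n%:R * K. Proof. by rewrite mulr_ge0// ltW. Qed.

Lemma glue_cvg : exists xoo : E, x k @[k --> \oo] --> xoo.
Proof.
suff : cvgn x by move=> /cvg_ex.
have ser : cvgn (series (fun k => `|x k.+1 - x k|)).
  apply: nondecreasing_is_cvgn; first by apply: nondecreasing_series.
  exists (n%:R * K * L) => _ [k _ <-]; rewrite /series /=.
  apply: (@le_trans _ _ (n%:R * K * \sum_(0 <= j < k) ell j)).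
    by rewrite mulr_sumr; apply: ler_sum => j _; exact: xincr.
  apply: ler_wpM2l => //; rewrite -lee_fin; apply: le_trans Llen.
  rewrite -sumEFin (eq_bigr (fun j => hlength G (T j) (T j.+1) (u j))); last by move=> j _; rewrite ellE.
  by apply: nneseries_lim_ge => j _ _; rewrite ellE lee_fin.
have : cvgn (series (fun k => x k.+1 - x k)).
  move: ser => /cauchy_cvgP/cauchy_seriesP ser.
  apply/cauchy_cvgP/cauchy_seriesP => e /ser; apply: filterS => m /=.
  by rewrite ger0_norm ?sumr_ge0//; apply: le_lt_trans; exact: ler_norm_sum.
have -> : series (fun k => x k.+1 - x k) = (fun k => x k - x 0%N).
  by apply/funext => k; rewrite /series /= telescope_sumr.
move=> /cvg_ex[l xl]; apply/cvg_ex; exists (l + x 0%N).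
have : (x k - x 0%N + x 0%N) @[k --> \oo] --> l + x 0%N.
  by apply: cvgD => //; exact: cvg_cst.
by under eq_fun do rewrite subrK.
Qed.

(** The glued curve, completed by xoo at time 1, is horizontal.  Its increments
    are bounded by the integral of its speed: on each interval by the bound for
    a single curve, up to T k by induction on k, and up to 1 by passing to the
    limit.  This bound gives absolute continuity. *)
Lemma glue_horizontal xoo : x k @[k --> \oo] --> xoo ->
  (cc_dist G (x 0%N) xoo <= L%:E)%E.
Proof.
move=> xcvg.
pose gam t := if t < 1 then g (idx t) t else xoo.
pose U i t := if t < 1 then u (idx t) i t else 0.
have gamE k t : T k <= t <= T k.+1 -> gam t = g k t.
  move=> /andP[kt]; rewrite le_eqVlt => /orP[/eqP ->|tk].
    by rewrite /gam Tlt1 (@idxP _ k.+1) ?lexx ?Tincr.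
  by rewrite /gam (lt_trans tk (Tlt1 _)) (@idxP _ k) ?kt.
have UE i k t : T k <= t < T k.+1 -> U i t = u k i t.
  by move=> tk; rewrite /U (@idxP _ k)//; case/andP: tk => _ tk; rewrite (lt_trans tk (Tlt1 _)).
pose P k := `[T k, T k.+1[%classic.
have mP k : measurable (P k) by exact: measurable_itv.
have Pu : `[0, 1[%classic = \bigcup_k P k.
  apply/seteqP; split => t /=.
    by rewrite in_itv /= => /andP[t0 /(idx_ex t0)[k tk]]; exists k => //=; rewrite in_itv.
  case=> k _ /=; rewrite !in_itv /= => /andP[kt tk].
  by rewrite (le_trans (Tge0 k) kt) (lt_trans tk (Tlt1 _)).
have PT : trivIset setT P.
  move=> i j _ _ [t []]; rewrite /P /= !in_itv /= => ti tj.
  by rewrite -(idxP ti) -(idxP tj).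
have speedE k t : P k t -> speed G U t = speed G (u k) t.
  rewrite /P /= in_itv /= => tk; rewrite /speed; congr Num.sqrt.
  by apply: eq_bigr => i _; rewrite (UE i k).
have set01 : `[0, 1]%classic = `[0, 1[%classic `|` [set (1:R)].
  by rewrite -set_itv1 -itv_bndbnd_setU ?bnd_simp ?ler01.
have mU i : cdeg G i = 1%N -> measurable_fun `[(0:R), (1:R)] (U i).
  move=> i1; rewrite set01 measurable_funU//; split; last exact: measurable_fun_set1.
  rewrite Pu; apply/measurable_fun_bigcup => // k.
  apply: (eq_measurable_fun (u k i)).
    by move=> t /set_mem; rewrite /P /= in_itv /= => /UE ->.
  have [_ iu _] := hg k.
  have /integrableP[/measurable_EFinP m _] := iu i i1.
  by apply: measurable_funS m => //; exact: subset_itv_co_cc.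
have mS : measurable_fun `[(0:R), (1:R)] (speed G U) by exact: measurable_speed.
have lenE : hlength G 0 1 U = (\sum_(k <oo) hlength G (T k) (T k.+1) (u k))%E.
  rewrite /hlength -integral_itv_bndo_bndc; last first.
    by apply/measurable_EFinP; apply: measurable_funS mS => //; exact: subset_itv_co_cc.
  have S0 t : (\bigcup_k P k) t -> (0%R <= (EFin \o speed G U) t)%E.
    by move=> _; rewrite lee_fin sqrtr_ge0.
  have mSP : measurable_fun (\bigcup_k P k) (EFin \o speed G U).
    rewrite -Pu; apply/measurable_EFinP; apply: measurable_funS mS => //.
    exact: subset_itv_co_cc.
  have := @ge0_integral_bigcup _ _ _ mu P (EFin \o speed G U) mP mSP S0 PT.
  rewrite -Pu => ->.
  apply: eq_eseriesr => k _.
  have mk : measurable_fun `[T k, T k.+1] (speed G (u k)).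
    have [_ iu _] := hg k.
    apply: measurable_speed => // i i1.
    by have /integrableP[/measurable_EFinP m _] := iu i i1.
  rewrite -[RHS]integral_itv_bndo_bndc; last first.
    by apply/measurable_EFinP; apply: measurable_funS mk => //; exact: subset_itv_co_cc.
  by apply: eq_integral => t /set_mem tk; congr EFin; exact: (speedE k).
have lenL : (hlength G 0 1 U <= L%:E)%E by rewrite lenE.
have iU i : cdeg G i = 1%N -> mu.-integrable `[0, 1] (EFin \o U i).
  move=> i1; apply/integrableP; split; first by apply/measurable_EFinP; exact: mU.
  apply: le_lt_trans (ltry L); apply: le_trans lenL.
  apply: ge0_le_integral => //.
  - by apply: measurableT_comp => //; apply/measurable_EFinP; exact: mU.
  - by apply/measurable_EFinP.
  - by move=> t _; rewrite lee_fin; exact: control_le_speed.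
pose w := cspeed G 0 1 U.
have iw : mu.-integrable setT (EFin \o w).
  have := speed_integrable (measurable_itv `[0, 1]) iU.
  by rewrite integrable_mkcond// restrict_EFin.
have w0 t : 0 <= w t by exact: cspeed_ge0.
have iw' : mu.-integrable setT (EFin \o (fun t => n%:R * K * w t)).
  exact: (integrableZl measurableT (n%:R * K) iw).
pose I a b := \int[mu]_(t in `[a, b]) (n%:R * K * w t).
have I0 a b : 0 <= I a b by apply: Rintegral_ge0 => t _; rewrite mulr_ge0.
have Isplit a b c : a <= b -> b <= c -> I a c = I a b + I b c.
  by move=> ab bc; exact: Rintegral_itv_split.
have piece k a b : T k <= a -> a <= b -> b <= T k.+1 -> `|gam b - gam a| <= I a b.
  move=> ka ab bk; rewrite (gamE k) ?(le_trans ka ab)// (gamE k) ?ka ?(le_trans ab bk)//.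
  apply: le_trans (@horizontal_increment _ _ _ G rho K K0 XK _ _ _ _ _ _ (hg k) _ ka ab bk) _.
    by move=> t /andP[at_ tb]; apply: grho; rewrite (le_trans ka at_) (le_trans tb bk).
  rewrite le_eqVlt; apply/orP; left; apply/eqP.
  have ick : mu.-integrable setT (EFin \o (fun t => n%:R * K * cspeed G (T k) (T k.+1) (u k) t)).
    exact: (integrableZl measurableT (n%:R * K) (cspeed_integrable (hg k))).
  rewrite -Rintegral_itv_bndo_bndc; last exact: integrable_sub.
  rewrite /I -[RHS]Rintegral_itv_bndo_bndc; last exact: integrable_sub.
  apply: eq_Rintegral => t /set_mem /=; rewrite in_itv /= => /andP[at_ tb].
  have Pt : P k t by rewrite /P /= in_itv /= (le_trans ka at_) (lt_le_trans tb bk).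
  congr (_ * _); rewrite /w /cspeed !patchE !mem_set /=.
  - by rewrite (speedE k).
  - by rewrite in_itv /= (le_trans (Tge0 k) (le_trans ka at_)) ltW// (lt_trans (lt_le_trans tb bk) (Tlt1 _)).
  - by rewrite in_itv /= (le_trans ka at_) ltW// (lt_le_trans tb bk).
have upto k a b : 0 <= a -> a <= b -> b <= T k -> `|gam b - gam a| <= I a b.
  elim: k a b => [|k IH] a b a0 ab bk.
    have -> : b = a by apply/eqP; rewrite eq_le ab (le_trans bk)// T0.
    by rewrite subrr normr0.
  have [bk'|kb] := leP b (T k); first exact: IH.
  have [ka|ak] := leP (T k) a; first exact: (piece k).
  rewrite (Isplit a (T k) b (ltW ak) (ltW kb)).
  have h1 := IH a (T k) a0 (ltW ak) (lexx _).
  have h2 := piece k (T k) b (lexx _) (ltW kb) bk.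
  have := ler_normD (gam b - gam (T k)) (gam (T k) - gam a).
  by rewrite addrA subrK; lra.
have bound a b : 0 <= a -> a <= b -> b <= 1 -> `|gam b - gam a| <= I a b.
  move=> a0 ab; rewrite le_eqVlt => /orP[/eqP b1|b1]; last first.
    by have [k bk] := Tcvg b1; apply: (upto k) => //; exact/ltW.
  have [a1|] := ltP a 1; last first.
    move=> a1; have -> : b = a by apply/eqP; rewrite eq_le ab b1 a1.
    by rewrite subrr normr0.
  rewrite b1; apply/ler_addgt0Pr => e e0.
  have [k0 ak0] := Tcvg a1.
  have /cvgrPdist_le /(_ e e0) [N _ HN] := xcvg.
  pose k := maxn N k0.
  have ak : a <= T k by rewrite (le_trans (ltW ak0))// Tle// leq_maxr.
  have xk : gam (T k) = x k by rewrite (gamE k)// lexx ltW.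
  have g1 : gam 1 = xoo by rewrite /gam ltxx.
  have h1 := HN k (leq_maxl _ _).
  rewrite -g1 /= -xk in h1.
  have h2 := upto k a (T k) a0 ak (lexx _).
  have h3 := Isplit a (T k) 1 ak (ltW (Tlt1 k)).
  have h4 := I0 (T k) 1.
  have := ler_normD (gam 1 - gam (T k)) (gam (T k) - gam a).
  by rewrite addrA subrK; lra.
have hU : horizontal G 0 1 gam U.
  split => //.
  - apply: (ac_of_integral_bound iw') => a b a0 ab b1.
    apply: le_trans (bound _ _ a0 ab b1) _.
    rewrite le_eqVlt; apply/orP; left; apply/eqP; apply: eq_Rintegral => t _.
    by rewrite ger0_norm// mulr_ge0.
  - have Nk k : mu.-negligible (~` [set t : R | t \in `[T k, T k.+1] ->
        is_derive t 1 (g k) (\sum_(i < n | cdeg G i == 1%N) u k i t *: X i (g k t))]).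
      by have [_ _] := hg k.
    have N1 : mu.-negligible (\bigcup_k [set T k]).
      apply: negligible_bigcup => k; exists [set T k]; split => //; exact: lebesgue_measure_set1.
    have N2 : mu.-negligible [set (1:R)].
      by exists [set (1:R)]; split => //; exact: lebesgue_measure_set1.
    have := negligibleU (negligible_bigcup Nk) (negligibleU N1 N2).
    apply: negligibleS => t /= Ht; apply: contrapT => /not_orP[H1 /not_orP[H2 H3]].
    apply: Ht => t01.
    move: t01; rewrite in_itv /= => /andP[t0 t1].
    have t1' : t < 1 by rewrite lt_neqAle t1 andbT; apply/eqP.
    have [k /andP[kt tk]] := idx_ex t0 t1'.
    have kt' : T k < t.
      by rewrite lt_neqAle kt andbT; apply/eqP => h; apply: H2; exists k.
    have gk : is_derive t 1 (g k) (\sum_(i < n | cdeg G i == 1%N) u k i t *: X i (g k t)).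
      apply: contrapT => h; apply: H1; exists k => //= h'; apply: h; apply: h'.
      by rewrite in_itv /= kt ltW.
    have gamt : gam t = g k t by apply: gamE; rewrite kt ltW.
    have ktk : T k <= t < T k.+1 by rewrite kt tk.
    have -> : \sum_(i < n | cdeg G i == 1%N) U i t *: X i (gam t) = \sum_(i < n | cdeg G i == 1%N) u k i t *: X i (g k t).
      by apply: eq_bigr => i _; rewrite gamt (UE i k t ktk).
    apply: expansion_is_derive => e e0.
    have [d d0 Hd] := is_derive_expansion gk e0.
    exists (Num.min d (Num.min (t - T k) (T k.+1 - t))).
      by rewrite !lt_min d0 !subr_gt0 kt' tk.
    move=> z; rewrite !lt_min => /andP[z1 /andP[z2 z3]].
    have zk : T k <= z <= T k.+1.
      by move: z2 z3; rewrite !ltr_norml => /andP[z2 z2'] /andP[z3 z3']; apply/andP; split; lra.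
    by rewrite (gamE k z zk) gamt; exact: Hd.
have := cc_dist_le_hlength hU.
have -> : gam 0 = x 0%N by rewrite (gamE 0%N) ?T0 ?lexx ?ltW// -T0.
have -> : gam 1 = xoo by rewrite /gam ltxx.
by move=> /le_trans; apply.
Qed.

End glue.

Section dyadic.
Context {R : realType}.

Definition dyad (k : nat) : R := 1 - 2^-1 ^+ k.

Lemma dyadS k : dyad k.+1 - dyad k = 2^-1 ^+ k.+1.
Proof. by rewrite /dyad exprS; lra. Qed.

Lemma dyad_cvg (t : R) : t < 1 -> exists k, t < dyad k.
Proof.
move=> t1; have t10 : 0 < 1 - t by rewrite subr_gt0.
have i0 : 0 < (1 - t)^-1 by rewrite invr_gt0.
exists (Num.bound (1 - t)^-1); set m := Num.bound _.
have h : (1 - t)^-1 < 2 ^+ m.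
  apply: lt_le_trans (archi_boundP (ltW i0)) _.
  by rewrite -natrX ler_nat ltnW// ltn_expl.
have : 2^-1 ^+ m < 1 - t.
  by rewrite exprVn -[ltRHS]invrK ltf_pV2// posrE ?exprn_gt0.
by rewrite /dyad; lra.
Qed.
End dyadic.

Section chain.
Context {R : realType} {n s : nat} (G : carnotGroup R n s).
Local Notation mu := (@lebesgue_measure R).
Local Notation E := 'rV[R]_n.
Local Notation X := (left_inv_field (cmul G)).
Variables (rho K : R).
Hypothesis K0 : 0 < K.
Hypothesis rho0 : 0 < rho.
Hypothesis XK : forall x : E, `|x| <= rho -> forall i, `|X i x| <= K.

(** The lengths ell k of the pieces need not be small in total, only
    individually: each curve starts near 0 and is too short to leave the ball
    where the fields are bounded. *)
Lemma horizontal_cat (g : nat -> R -> E) (u : nat -> 'I_n -> R -> R) (ell : nat -> R) (L : R) :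
  (forall k, horizontal G 0 1 (g k) (u k)) ->
  (forall k, g k 1 = g k.+1 0) ->
  (forall k, `|g k 0| <= rho / 2) ->
  (forall k, (hlength G 0 1 (u k) <= (ell k)%:E)%E) ->
  (forall k, n%:R * K * ell k < rho / 2) ->
  (forall N, \sum_(k < N) ell k <= L) ->
  (exists xoo : E, g k 0 @[k --> \oo] --> xoo) /\
  (forall xoo : E, g k 0 @[k --> \oo] --> xoo -> (cc_dist G (g 0%N 0%R) xoo <= L%:E)%E).
Proof.
move=> hg gg g0 hell ellr sumL.
(* t |-> al k * t + be k maps [dyad k, dyad k.+1] onto [0, 1]. *)
pose al k : R := 2 ^+ k.+1.
pose be k : R := - al k * dyad k.
have al0 k : 0 < al k by rewrite exprn_gt0.
have alS k : al k * (dyad k.+1 - dyad k) = 1.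
  by rewrite dyadS exprVn mulfV// gt_eqF.
have incr k : dyad k < dyad k.+1 :> R by rewrite -subr_gt0 dyadS exprn_gt0// invr_gt0.
have itv k t : (dyad k <= t <= dyad k.+1) = (0 <= al k * t + be k <= 1).
  have -> : al k * t + be k = al k * (t - dyad k) by rewrite /be; ring.
  by rewrite pmulr_rge0// subr_ge0 -(alS k) ler_pM2l// lerD2r.
have aff k := horizontal_affine (lt0r_neq0 (al0 k)) (itv k) (hg k).
pose g' k t := g k (al k * t + be k).
have g'0 k : g' k (dyad k) = g k 0.
  by rewrite /g' /be; congr (g k _); ring.
have g'1 k : g' k (dyad k.+1) = g k 1.
  by rewrite /g' -(alS k) /be; congr (g k _); ring.
have stay k t : dyad k <= t <= dyad k.+1 -> `|g' k t| <= rho.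
  move=> tk; apply: (@horizontal_stay _ _ _ G rho K K0 XK 0 1 (g k) (u k)) => //.
    apply: le_lt_trans (ellr k); apply: ler_wpM2l; first by rewrite mulr_ge0// ltW.
    by rewrite -lee_fin -(hlengthE (hg k)).
  by rewrite -itv.
pose u' k i t := al k * u k i (al k * t + be k).
have sumL' : (\sum_(k <oo) hlength G (dyad k) (dyad k.+1) (u' k) <= L%:E)%E.
  apply: lime_le.
    by apply: is_cvg_nneseries => k _ _; rewrite integral_ge0// => t _; rewrite lee_fin sqrtr_ge0.
  apply: nearW => N.
  apply: (@le_trans _ _ (\sum_(k < N) ell k)%:E); last by rewrite lee_fin.
  rewrite big_mkord -sumEFin; apply: lee_sum => k _.
  by have [_ ->] := aff k.
have g'g k : g' k (dyad k.+1) = g' k.+1 (dyad k.+1) by rewrite g'1 g'0.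
have T0 : dyad 0 = 0 :> R by rewrite /dyad expr0 subrr.
have Tlt1 k : dyad k < 1 :> R by rewrite /dyad ltrBlDr ltrDl exprn_gt0// invr_gt0.
have hg' k := (aff k).1.
have E0 : (fun k => g' k (dyad k)) = (fun k => g k 0) by apply/funext => k.
split.
  have [l] := glue_cvg K0 XK incr hg' g'g stay sumL'.
  by rewrite E0 => h; exists l.
move=> xoo; rewrite -E0 => h.
have := glue_horizontal K0 XK T0 incr Tlt1 dyad_cvg hg' g'g stay sumL' h.
by rewrite -/(g' _ _) g'0.
Qed.

(** The radii decrease so fast that the curves joining x k to x k.+1, x k.+1 to
    x k.+2 and so on have total length at most (2/3) r k < r k. *)
Lemma cc_dist_complete (x : nat -> E) (r : nat -> R) :
  (forall k, `|x k| <= rho / 2) -> (forall k, 0 < r k) -> (forall k, r k.+1 <= r k / 4) ->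
  n%:R * K * r 0%N <= rho / 2 ->
  (forall k, (cc_dist G (x k) (x k.+1) < (r k / 2)%:E)%E) ->
  exists2 xoo : E, x k @[k --> \oo] --> xoo & forall k, (cc_dist G (x k) xoo < (r k)%:E)%E.
Proof.
move=> xr r0 r4 nKr xd.
have /choice[gu Hgu] k : exists gu : (R -> E) * ('I_n -> R -> R),
   [/\ horizontal G 0 1 gu.1 gu.2, gu.1 0 = x k, gu.1 1 = x k.+1 & (hlength G 0 1 gu.2 < (r k / 2)%:E)%E].
  by have [g [u H]] := cc_dist_ltP (xd k); exists (g, u).
have nK0 : 0 <= n%:R * K by rewrite mulr_ge0// ltW.
have rle k : r k <= r 0%N.
  by elim: k => // k IH; apply: le_trans (r4 k) _; have := r0 k; lra.
have tail m := @horizontal_cat (fun k => (gu (m + k)%N).1) (fun k => (gu (m + k)%N).2)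
   (fun k => r (m + k)%N / 2) (2 / 3 * r m).
have tailH m : (exists xoo : E, x (m + k)%N @[k --> \oo] --> xoo) /\
  (forall xoo : E, x (m + k)%N @[k --> \oo] --> xoo -> (cc_dist G (x m) xoo <= (2 / 3 * r m)%:E)%E).
  have E0 : (fun k => (gu (m + k)%N).1 0) = (fun k => x (m + k)%N).
    by apply/funext => k; have [] := Hgu (m + k)%N.
  have := tail m; rewrite E0; have [_ -> _ _] := Hgu (m + 0)%N; rewrite addn0; apply.
  - by move=> k; have [] := Hgu (m + k)%N.
  - move=> k; have [_ _ -> _] := Hgu (m + k)%N; have [_ -> _ _] := Hgu (m + k.+1)%N.
    by rewrite addnS.
  - by move=> k; have [_ -> _ _] := Hgu (m + k)%N.
  - by move=> k; have [_ _ _ h] := Hgu (m + k)%N; exact/ltW.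
  - move=> k; have := ler_wpM2l nK0 (rle (m + k)%N); have := rho0.
    by rewrite mulrA; lra.
  - move=> N.
    have : \sum_(k < N) r (m + k)%N / 2 <= 2 / 3 * (r m - r (m + N)%N).
      elim: N => [|N IH]; first by rewrite big_ord0 addn0 subrr mulr0.
      rewrite big_ord_recr /= addnS.
      have := r4 (m + N)%N; have := r0 (m + N)%N; have := r0 (m + N).+1; lra.
    have := r0 (m + N)%N; lra.
have [[xoo xcvg] _] := tailH 0%N.
exists xoo => // k.
have [_ /(_ xoo)] := tailH k.
have h : x (k + j)%N @[j --> \oo] --> xoo.
  under eq_fun do rewrite addnC.
  by move: xcvg; rewrite -(cvg_shiftn k).
move=> /(_ h) /le_lt_trans; apply; rewrite lte_fin; have := r0 k; lra.
Qed.

Lemma hlength_cst a b : hlength G a b (fun _ _ => 0) = 0%E.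
Proof.
rewrite /hlength; apply: integral0_eq => t _.
by rewrite big1 ?sqrtr0// => i _; rewrite expr0n.
Qed.

Lemma horizontal_cst a b z : horizontal G a b (fun=> z) (fun _ _ => 0).
Proof.
split.
- move=> e e0; exists 1 => // N p q _ _ _; rewrite big1// => i _.
  by rewrite subrr normr0.
- by move=> i _; exact: integrable0.
- apply: aeW => t _; rewrite big1; last by move=> i _; rewrite scale0r.
  exact: is_derive_cst.
Qed.

Hypothesis n_gt0 : (0 < n)%N.

(** Two curves followed by constant ones. *)
Lemma cc_dist_triangle_local x y z (r1 r2 : R) : `|x| <= rho / 2 -> `|y| <= rho / 2 ->
  `|z| <= rho / 2 -> n%:R * K * r1 <= rho / 2 -> n%:R * K * r2 <= rho / 2 ->
  (cc_dist G x y < r1%:E)%E -> (cc_dist G y z < r2%:E)%E -> (cc_dist G x z < (r1 + r2)%:E)%E.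
Proof.
move=> xr yr zr nK1 nK2 /cc_dist_ltP[g1 [u1 [h1 g10 g11]]].
rewrite (hlengthE h1) => l1.
move=> /cc_dist_ltP[g2 [u2 [h2 g20 g21]]]; rewrite (hlengthE h2) => l2.
set L1 := \int[mu]_(_ in _) _ in l1; set L2 := \int[mu]_(_ in _) _ in l2.
rewrite !lte_fin in l1 l2.
have L10 : 0 <= L1 by apply: Rintegral_ge0 => t _; exact: cspeed_ge0.
have L20 : 0 <= L2 by apply: Rintegral_ge0 => t _; exact: cspeed_ge0.
have nK : 0 < n%:R * K by rewrite mulr_gt0// ltr0n.
pose g (k : nat) : R -> E := match k with 0%N => g1 | 1%N => g2 | _ => fun=> z end.
pose u (k : nat) : 'I_n -> R -> R := match k with 0%N => u1 | 1%N => u2 | _ => fun _ _ => 0 end.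
pose ell (k : nat) : R := match k with 0%N => L1 | 1%N => L2 | _ => 0 end.
have [|||||| _ H] := @horizontal_cat g u ell (L1 + L2).
- by move=> [|[|k]]; [exact: h1 | exact: h2 | exact: horizontal_cst].
- by case=> [|[|k]] //=; rewrite ?g11 ?g20.
- by case=> [|[|k]] //=; rewrite ?g10 ?g20.
- case=> [|[|k]] /=; first by rewrite (hlengthE h1).
    by rewrite (hlengthE h2).
  by rewrite hlength_cst.
- case=> [|[|k]] /=.
  + by apply: lt_le_trans nK1; rewrite ltr_pM2l.
  + by apply: lt_le_trans nK2; rewrite ltr_pM2l.
  + by rewrite mulr0 divr_gt0.
- case=> [|[|N]]; rewrite ?big_ord0 ?addr_ge0//.
    by rewrite big_ord_recl big_ord0 /= addr0 lerDl.
  by rewrite !big_ord_recl /= big1 ?addr0.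
have gz : g k 0 @[k --> \oo] --> z.
  by apply: cvg_near_cst; exists 2%N => // -[|[|k]].
have := H _ gz; rewrite /= g10 => /le_lt_trans; apply.
by rewrite lte_fin ltrD.
Qed.
End chain.

(** * Left-invariant fields and horizontal lines *)

Section mean_value.
Context {R : realType} {n m : nat}.
Local Notation E := 'rV[R]_n.
Local Notation E' := 'rV[R]_m.

Lemma mean_value_segment (h : R -> E') (dh : R -> E') (a b Lam : R) : a <= b ->
  (forall t, a <= t <= b -> is_derive t 1 h (dh t)) ->
  (forall t, a <= t <= b -> `|dh t| <= Lam) -> `|h b - h a| <= Lam * (b - a).
Proof.
move=> ab hder hLam.
have Lam0 : 0 <= Lam by apply: le_trans (hLam a _); rewrite ?lexx.
apply: normr_le_coord => [|j]; first by rewrite mulr_ge0// subr_ge0.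
have [||c cab] := @MVT_segment R (fun t => h t 0 j) (fun t => dh t 0 j) a b ab.
- by move=> t; rewrite in_itv /= => /andP[/ltW at_ /ltW tb]; apply: is_derive_coord; apply: hder; rewrite at_.
- apply: derivable_within_continuous => t; rewrite in_itv /= => tab.
  by have [] := is_derive_coord j (hder t tab).
rewrite !mxE => ->; rewrite normrM [`|b - a|]ger0_norm ?subr_ge0// ler_wpM2r ?subr_ge0//.
by apply: le_trans (normr_coord _ _) (hLam c _); move: cab; rewrite in_itv.
Qed.

Lemma is_derive_line (f : E -> E') (z v : E) (t : R) :
  derivable f (z + t *: v) v -> is_derive t 1 (fun s => f (z + s *: v)) ('D_v f (z + t *: v)).
Proof.
move=> df.
have E0 : (fun h : R => h^-1 *: (f (z + (h *: (1:R) + t) *: v) - f (z + t *: v))) =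
          (fun h : R => h^-1 *: (f (h *: v + (z + t *: v)) - f (z + t *: v))).
  by apply/funext => h; rewrite [_%:A]mulr1 scalerDl addrCA.
by split; rewrite /derivable /derive E0.
Qed.

(** Change the coordinates one at a time: in the sup norm the intermediate
    points stay in the same ball, and the mean value inequality applies in each
    direction of the basis. *)
Lemma C1_locally_lipschitz (f : E -> E') (y : E) : Ck 1 f ->
  exists d Lam : R, [/\ 0 < d, 0 <= Lam & forall a b, `|a - y| <= d -> `|b - y| <= d -> `|f a - f b| <= Lam * `|a - b|].
Proof.
move=> [cf Hf].
have near1 : \forall z \near y, forall i : 'I_n, `|'D_(delta_mx 0 i) f y - 'D_(delta_mx 0 i) f z| <= 1.
  apply: (@filter_forall _ 'I_n (fun (i : 'I_n) (z : E) => `|'D_(delta_mx 0 i) f y - 'D_(delta_mx 0 i) f z| <= 1) (nbhs y)) => i.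
  have [_ cD] := Hf (delta_mx 0 i).
  by have /cvgrPdist_le /(_ 1 ltr01) := cD y.
pose C := \sum_(i < n) `|'D_(delta_mx 0 i) f y| + 1.
have C0 : 0 <= C by rewrite addr_ge0// sumr_ge0.
have /nbhs_normP[d0 /= d00 Hd0] := near1.
exists (d0 / 2), (n%:R * C); split; [by rewrite divr_gt0 | by rewrite mulr_ge0 |].
move=> a b ay by_.
have key (p q : E') : `|p - q| <= 1 -> `|q| <= `|p| + 1.
  move=> pq; rewrite -{1}(subKr p q); apply: le_trans (ler_normB _ _) _.
  by rewrite lerD2l.
have bound z i : `|z - y| <= d0 / 2 -> `|'D_(delta_mx 0 i) f z| <= C.
  move=> zy; have zball : ball_ Num.Def.normr y d0 z.
    by rewrite /ball_ /= distrC; apply: le_lt_trans zy _; lra.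
  have := Hd0 z zball i.
  have h2 : `|'D_(delta_mx 0 i) f y| <= \sum_(i < n) `|'D_(delta_mx 0 i) f y|.
    by rewrite (bigD1 i)//= lerDl sumr_ge0.
  by move=> /key/le_trans; apply; rewrite /C lerD2r.
pose z (k : nat) : E := \row_j (if (j < k)%N then a 0 j else b 0 j).
have step (k : 'I_n) : `|f (z k.+1) - f (z k)| <= C * `|a - b|.
  pose c := a 0 k - b 0 k.
  have cab : `|c| <= `|a - b|.
    by have := normr_coord (a - b) k; rewrite !mxE.
  have zS : z k.+1 = z k + c *: delta_mx 0 k.
    apply/rowP => j; rewrite !mxE ?eqxx /=.
    have [->|jk] := eqVneq j k; first by rewrite ltnSn ltnn /c mulr1 addrC subrK.
    by rewrite ltnS leq_eqVlt (inj_eq val_inj) (negbTE jk) /= mulr0 addr0.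
  have box r : (0 <= r <= c \/ c <= r <= 0) -> `|z k + r *: delta_mx 0 k - y| <= d0 / 2.
    move=> rc; apply: normr_le_coord => [|j]; first by rewrite divr_ge0// ltW.
    have aj := le_trans (normr_coord (a - y) j) ay.
    have bj := le_trans (normr_coord (b - y) j) by_.
    rewrite !mxE ?eqxx /=; move: aj bj; rewrite !mxE.
    have [->|jk] := eqVneq j k.
      rewrite ltnn mulr1 => /ler_normlP[a1 a2] /ler_normlP[b1 b2].
      by apply/ler_normlP; rewrite /c in rc; split; lra.
    by rewrite mulr0 addr0; case: ifP.
  have der (t : R) : is_derive t 1 (fun s => f (z k + s *: delta_mx 0 k)) ('D_(delta_mx 0 k) f (z k + t *: delta_mx 0 k)).
    by apply: is_derive_line; have [] := Hf (delta_mx 0 k).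
  rewrite zS; have z0 : f (z k) = f (z k + (0:R) *: delta_mx 0 k) by rewrite scale0r addr0.
  apply: le_trans (ler_wpM2l C0 cab); rewrite z0.
  have [c0|c0] := leP 0 c.
  - have := mean_value_segment (Lam := C) c0 (fun t _ => der t).
    rewrite subr0 (ger0_norm c0); apply => t tc.
    by apply: bound; apply: box; left.
  - have := mean_value_segment (Lam := C) (ltW c0) (fun t _ => der t).
    rewrite sub0r (ltr0_norm c0) distrC; apply => t tc.
    by apply: bound; apply: box; right.
have all k : (k <= n)%N -> `|f (z k) - f (z 0%N)| <= k%:R * C * `|a - b|.
  elim: k => [|k IH] kn; first by rewrite subrr normr0 !mul0r.
  have := step (Ordinal kn); have := IH (ltnW kn).
  have := ler_normD (f (z k.+1) - f (z k)) (f (z k) - f (z 0%N)).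
  rewrite /= addrA subrK -natr1; lra.
have := all n (leqnn n).
have -> : z n = a by apply/rowP => j; rewrite mxE ltn_ord.
by have -> : z 0%N = b by apply/rowP => j; rewrite mxE.
Qed.
End mean_value.

Lemma continuous_pairl (U V : topologicalType) (x : U) : continuous (fun y : V => (x, y)).
Proof.
by move=> y; apply: (@cvg_pair _ _ _ (nbhs y) (nbhs x) (nbhs y)); [exact: cvg_cst | exact: cvg_id].
Qed.

Lemma continuous_pairr (U V : topologicalType) (y : V) : continuous (fun x : U => (x, y)).
Proof.
by move=> x; apply: (@cvg_pair _ _ _ (nbhs x) (nbhs x) (nbhs y)); [exact: cvg_id | exact: cvg_cst].
Qed.

Section group_lines.
Context {R : realType} {n s : nat} (G : carnotGroup R n s).
Local Notation mu := (@lebesgue_measure R).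
Local Notation E := 'rV[R]_n.
Local Notation X := (left_inv_field (cmul G)).
Local Notation "x ** y" := (cmul G x y) (at level 40).
Local Notation e_ i := (delta_mx 0 i : E).

Let M (p : E * E) : E := p.1 ** p.2.

Let M1 : Ck 1 M. Proof. exact: (cmul_smooth G 1). Qed.

Let mul_quotient x y v : (fun h : R => h^-1 *: (M (h *: ((0, v) : E * E) + (x, y)) - M (x, y))) =
  (fun h : R => h^-1 *: (x ** (h *: v + y) - x ** y)).
Proof. by apply/funext => h; rewrite /M /= scaler0 add0r. Qed.

Lemma derivable_cmul x y v : derivable (cmul G x) y v.
Proof.
have [_ /(_ ((0, v) : E * E))[/(_ (x, y)) + _]] := M1.
by rewrite /derivable mul_quotient.
Qed.

Let derive_cmul x y v : 'D_v (cmul G x) y = 'D_((0, v) : E * E) M (x, y).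
Proof. by rewrite /derive mul_quotient. Qed.

Lemma cmul_C1 x : Ck 1 (cmul G x).
Proof.
have [cM dM] := M1.
have cpair : continuous (fun y : E => (x, y)).
  exact: continuous_pairl.
split; first by move=> y; apply: (continuous_comp (cpair y) (cM (x, y))).
move=> v; split; first by move=> y; exact: derivable_cmul.
rewrite (_ : 'D_v (cmul G x) = 'D_((0, v) : E * E) M \o (fun y : E => (x, y))); last first.
  by apply/funext => y; rewrite derive_cmul.
have [_ cD] := dM ((0, v) : E * E).
by move=> y; apply: (continuous_comp (cpair y) (cD (x, y))).
Qed.

Lemma left_inv_field_continuous i : continuous (X i).
Proof.
have [cM /(_ ((0, e_ i) : E * E))[_ cD]] := M1.
have cpair : continuous (fun x : E => (x, 0 : E)).
  exact: continuous_pairr.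
rewrite (_ : X i = 'D_((0, e_ i) : E * E) M \o (fun x : E => (x, 0 : E))); last first.
  by apply/funext => y; rewrite /left_inv_field derive_cmul.
by move=> y; apply: (continuous_comp (cpair y) (cD (y, 0))).
Qed.

Lemma left_inv_field0 i : X i 0 = e_ i.
Proof.
rewrite /left_inv_field (_ : cmul G 0 = id); first exact: derive_id.
by apply/funext => x; exact: cmul0x.
Qed.

(** The line r |-> r e_i is the integral curve of X_i through the identity. *)
Lemma field_on_axis i (t : R) : X i (t *: e_ i) = e_ i.
Proof.
have [_ h1] := cexp G (e_ i) t.
have [_ h2] : is_derive t 1 (fun r : R => r *: e_ i) (e_ i).
  apply: expansion_is_derive => e e0; exists 1 => // z _.
  by rewrite scalerBl subrr normr0 mulr_ge0// ltW.
rewrite h1 in h2.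
rewrite (bigD1 i)//= big1 ?addr0 in h2; last first.
  by move=> j ji; rewrite mxE eqxx (negbTE ji) scale0r.
by rewrite mxE !eqxx scale1r in h2.
Qed.

(** Write y = t e_i.  At y the line y + h e_i and the translated line y (h e_i)
    are tangent, as both have velocity e_i; left multiplication by x is locally
    Lipschitz, hence sends them to tangent curves, and the second one becomes
    (x y) (h e_i), whose velocity is X_i (x y) by definition. *)
Lemma line_is_derive i x (t : R) :
  is_derive t 1 (fun r : R => x ** (r *: e_ i)) (X i (x ** (t *: e_ i))).
Proof.
set y := t *: e_ i; set v := X i _.
have [d [Lam [d0 Lam0 HL]]] := C1_locally_lipschitz y (cmul_C1 x).
have m_der : is_derive (0:R) 1 (fun r : R => y ** (r *: e_ i)) (e_ i).
  have := @is_derive_line R n n (cmul G y) 0 (e_ i) 0.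
  rewrite scale0r addr0 => /(_ (@derivable_cmul y 0 (e_ i))).
  rewrite -[X in is_derive _ _ _ X]/(X i y) field_on_axis.
  by under eq_fun do rewrite add0r.
have f_der : is_derive (0:R) 1 (fun r : R => (x ** y) ** (r *: e_ i)) v.
  have := @is_derive_line R n n (cmul G (x ** y)) 0 (e_ i) 0.
  rewrite scale0r addr0 => /(_ (@derivable_cmul _ 0 (e_ i))).
  by under eq_fun do rewrite add0r.
apply: expansion_is_derive => e e0.
have Lam1 : 0 < Lam + 1 by rewrite ltr_wpDl.
have ei1 : 0 < `|e_ i| + 1 by rewrite ltr_wpDl.
have e20 : 0 < e / 2 by rewrite divr_gt0.
have e30 : 0 < e / 2 / (Lam + 1) by rewrite divr_gt0.
have [d1 d10 H1] := is_derive_expansion m_der e30.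
have [d2 d20 H2] := is_derive_expansion f_der e20.
have [d3 d30 H3] := is_derive_expansion m_der ltr01.
exists (Num.min (Num.min d1 d2) (Num.min d3 (d / 2 / (`|e_ i| + 1)))).
  by rewrite !lt_min d10 d20 d30 /= !divr_gt0.
move=> z; rewrite !lt_min => /andP[/andP[z1 z2] /andP[z3 z4]].
set h := z - t.
have zE : z *: e_ i = y + h *: e_ i by rewrite -scalerDl /h subrKC.
have m0 : y ** ((0:R) *: e_ i) = y by rewrite scale0r cmulx0.
have := H1 h; rewrite subr0 m0 => /(_ z1) {}H1.
have := H3 h; rewrite subr0 m0 => /(_ z3) {}H3.
have := H2 h; rewrite subr0 scale0r cmulx0 -cmulA => /(_ z2) {}H2.
have he : `|h *: e_ i| <= d / 2.
  rewrite normrZ; apply: (@le_trans _ _ (`|h| * (`|e_ i| + 1))).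
    by rewrite ler_wpM2l// lerDl.
  by rewrite -ler_pdivlMr// ltW.
set p := y ** (h *: e_ i) in H1 H2 H3 *; set q := y + h *: e_ i in zE *.
have pq : `|p - q| <= `|h| by rewrite /q opprD addrA; move: H3; rewrite mul1r.
have pq1 : `|p - q| <= e / 2 / (Lam + 1) * `|h| by rewrite /q opprD addrA.
have qy : `|q - y| <= d / 2 by rewrite /q [y + _]addrC addrK.
have py : `|p - y| <= d.
  have := ler_normD (p - q) (q - y); rewrite addrA subrK.
  have hd : `|h| <= d / 2.
    apply: (@le_trans _ _ (`|h| * (`|e_ i| + 1))).
      by rewrite ler_peMr// lerDr.
    by rewrite -ler_pdivlMr// ltW.
  lra.
have fpq : `|x ** q - x ** p| <= e / 2 * `|h|.
  rewrite distrC; apply: le_trans (HL p q py _) _; first by apply: le_trans qy _; lra.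
  apply: le_trans (ler_wpM2l Lam0 pq1) _.
  rewrite [_ / (Lam + 1) * _]mulrAC mulrCA -[leRHS]mulr1 ler_wpM2l//.
    by rewrite mulr_ge0// ltW.
  by rewrite ler_pdivrMr// mul1r lerDl.
rewrite zE.
have -> : x ** q - x ** y - h *: v = (x ** q - x ** p) + (x ** p - x ** y - h *: v).
  by rewrite !addrA subrK.
apply: le_trans (ler_normD _ _) _; rewrite [e in leRHS]splitr mulrDl.
exact: lerD.
Qed.

End group_lines.

Section moves.
Context {R : realType} {n s : nat} (G : carnotGroup R n s).
Local Notation mu := (@lebesgue_measure R).
Local Notation E := 'rV[R]_n.
Local Notation X := (left_inv_field (cmul G)).
Local Notation "x ** y" := (cmul G x y) (at level 40).
Local Notation e_ i := (delta_mx 0 i : E).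

Lemma norm_delta_le1 i : `|e_ i| <= 1.
Proof.
apply: normr_le_coord => // j; rewrite mxE.
by case: (_ && _); rewrite ?normr1 ?normr0.
Qed.

(** The fields equal the standard basis at 0 and are continuous, so near 0 they
    are bounded by 2 and the i0-th component of X_i0 is close to 1. *)
Lemma local_frame (i0 : 'I_n) : exists rho rho1 : R, [/\ 0 < rho, 0 < rho1,
  (forall x : E, `|x| <= rho -> forall i, `|X i x| <= 2),
  (forall x : E, `|x| <= rho -> `|X i0 x 0 i0 - 1| <= 2^-1) &
  (forall (x : E) (t : R), `|x| <= rho1 -> `|t| <= rho1 -> `|x ** (t *: e_ i0)| <= rho)].
Proof.
have near1 : \forall z \near (0 : E), forall i : 'I_n, `|X i 0 - X i z| <= 2^-1.
  apply: (@filter_forall _ 'I_n (fun (i : 'I_n) (z : E) => `|X i 0 - X i z| <= 2^-1) (nbhs (0 : E))) => i.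
  have h : (0:R) < 2^-1 by lra.
  by have /cvgrPdist_le /(_ _ h) := @left_inv_field_continuous _ _ _ G i 0.
have /nbhs_normP[d /= d0 Hd] := near1.
have close x i : `|x| <= d / 2 -> `|e_ i - X i x| <= 2^-1.
  move=> xd; rewrite -(left_inv_field0 G i); apply: Hd.
  by rewrite /ball_ /= sub0r normrN; apply: le_lt_trans xd _; lra.
have d20 : 0 < d / 2 by lra.
have cM : continuous (fun p : E * E => p.1 ** p.2) by exact: (cmul_smooth G 0).
have [[A B] /= [nA nB] AB] := cM (0, 0) _ (nbhsx_ballx _ _ d20).
have /nbhs_normP[r1 /= r10 Hr1] := nA.
have /nbhs_normP[r2 /= r20 Hr2] := nB.
pose r := Num.min r1 r2.
have r0 : 0 < r by rewrite lt_min r10.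
have rr1 : r <= r1 by rewrite ge_min lexx.
have rr2 : r <= r2 by rewrite ge_min lexx orbT.
exists (d / 2), (r / 2); split => //; first by lra.
- move=> x xd i; have := close x i xd; have := norm_delta_le1 i.
  have := ler_normB (e_ i) (e_ i - X i x); rewrite subKr; lra.
- move=> x xd; have := le_trans (normr_coord _ i0) (close x i0 xd).
  by rewrite !mxE !eqxx /= distrC.
- move=> x t xr tr.
  have := AB (x, t *: e_ i0); rewrite /= -ball_normE /ball_ /= cmul0x sub0r normrN => H; apply/ltW/H; split => /=.
    by apply: Hr1; rewrite /ball_ /= sub0r normrN; lra.
  apply: Hr2; rewrite /ball_ /= sub0r normrN normrZ; apply: (@le_lt_trans _ _ (`|t| * 1)); last lra.
  by rewrite ler_wpM2l// norm_delta_le1.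
Qed.

Lemma ac_on_lipschitz {V : normedModType R} (f : R -> V) (a b Lam : R) : 0 <= Lam ->
  (forall x y, a <= x -> x <= y -> y <= b -> `|f y - f x| <= Lam * (y - x)) -> ac_on a b f.
Proof.
move=> Lam0 Hf e e0; exists (e / (Lam + 1)); first by rewrite divr_gt0// ltr_wpDl.
move=> N p q Hpq _; rewrite ltr_pdivlMr ?ltr_wpDl// => sd.
apply: le_lt_trans sd; rewrite mulrC mulr_sumr; apply: ler_sum => i _.
have [h1 [h2 h3]] := Hpq i; apply: le_trans (Hf _ _ h1 h2 h3) _.
by rewrite ler_wpM2r ?subr_ge0// lerDl.
Qed.

Variables (i0 : 'I_n) (rho rho1 : R).
Hypothesis i01 : cdeg G i0 = 1%N.
Hypothesis X2 : forall x : E, `|x| <= rho -> forall i, `|X i x| <= 2.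
Hypothesis Xi0 : forall x : E, `|x| <= rho -> `|X i0 x 0 i0 - 1| <= 2^-1.
Hypothesis small : forall (x : E) (t : R), `|x| <= rho1 -> `|t| <= rho1 -> `|x ** (t *: e_ i0)| <= rho.

Lemma cc_dist_line (x : E) (tau : R) : `|x| <= rho1 -> `|tau| <= rho1 ->
  (cc_dist G x (x ** (tau *: e_ i0)) <= `|tau|%:E)%E.
Proof.
move=> xr taur.
pose g r := x ** ((r * tau) *: e_ i0).
pose u (i : 'I_n) (t : R) := if i == i0 then tau else 0.
have gder (r : R) : is_derive r 1 g (tau *: X i0 (g r)).
  apply: expansion_is_derive => e e0.
  have tau1 : 0 < `|tau| + 1 by rewrite ltr_wpDl.
  have [d d0 Hd] := is_derive_expansion (line_is_derive G i0 x (r * tau)) (divr_gt0 e0 tau1).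
  exists (d / (`|tau| + 1)); first by rewrite divr_gt0.
  move=> z; rewrite ltr_pdivlMr// => zr.
  have zt : z * tau - r * tau = (z - r) * tau by ring.
  have ztd : `|(z - r) * tau| <= `|z - r| * (`|tau| + 1).
    by rewrite normrM ler_wpM2l// lerDl.
  have := Hd (z * tau); rewrite zt => /(_ (le_lt_trans ztd zr)).
  rewrite -[((z - r) * tau) *: _]scalerA => /le_trans; apply.
  rewrite -mulrA ler_wpM2l ?(ltW e0)//.
  by rewrite ler_pdivrMl// [leRHS]mulrC.
have hg : horizontal G 0 1 g u.
  split.
  - apply: (@ac_on_lipschitz _ g 0 1 (`|tau| * 2)) => [|a b a0 ab b1]; first by rewrite mulr_ge0.
    apply: (mean_value_segment ab (fun t _ => gder t)) => t /andP[at_ tb].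
    rewrite normrZ ler_wpM2l// X2// small// normrM.
    apply: le_trans taur; rewrite ler_piMl// ger0_norm; [exact: le_trans tb b1 | exact: le_trans a0 at_].
  - move=> i _; apply: continuous_compact_integrable; first exact: segment_compact.
    by apply: continuous_subspaceT => ?; exact: cvg_cst.
  - apply: aeW => t _; rewrite (bigD1 i0) ?i01//= big1 ?addr0.
      by rewrite /u eqxx; exact: gder.
    by move=> i /andP[_ ii]; rewrite /u (negbTE ii) scale0r.
have := cc_dist_le_hlength hg.
rewrite /g mul0r scale0r cmulx0 mul1r => /le_trans; apply.
rewrite /hlength (eq_integral (fun=> `|tau|%:E)); last first.
  move=> t _; rewrite (bigD1 i0) ?i01//= big1 ?addr0; last first.
    by move=> i /andP[_ ii]; rewrite /u (negbTE ii) expr0n.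
  by rewrite /u eqxx sqrtr_sqr.
by rewrite integral_cst//= lebesgue_measure_itv /= lte01 oppr0 adde0 mule1.
Qed.

(** Along the line x (r e_i0) the coordinate i0 has slope at least 1/2, so the
    value x_i0 + t is attained for some r with |r| <= 2 |t|. *)
Lemma cc_dist_move_coord (x : E) (t : R) : `|x| <= rho1 -> 2 * `|t| <= rho1 ->
  exists2 y : E, y 0 i0 = x 0 i0 + t & (cc_dist G x y <= (2 * `|t|)%:E)%E.
Proof.
move=> xr tr.
pose phi r := (x ** (r *: e_ i0)) 0 i0.
have phider (r : R) : is_derive r 1 phi (X i0 (x ** (r *: e_ i0)) 0 i0).
  exact: is_derive_coord (line_is_derive G i0 x r).
have phi0 : phi 0 = x 0 i0 by rewrite /phi scale0r cmulx0.
have cphi a b : {within `[a, b], continuous phi}.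
  apply: derivable_within_continuous => r _.
  by have [] := phider r.
have slope a b : a <= b -> `|a| <= rho1 -> `|b| <= rho1 -> (b - a) / 2 <= phi b - phi a.
  move=> ab ar br.
  have [|c cab ->] := @MVT_segment R phi (fun r => X i0 (x ** (r *: e_ i0)) 0 i0) a b ab.
    exact: cphi.
  rewrite mulrC ler_wpM2r ?subr_ge0//.
  have : `|X i0 (x ** (c *: e_ i0)) 0 i0 - 1| <= 2^-1.
    apply: Xi0; apply: small => //; move: cab; rewrite in_itv /= => /andP[ac cb].
    by move: ar br => /ler_normlP[a1 a2] /ler_normlP[b1 b2]; apply/ler_normlP; split; lra.
  by move=> /ler_normlP[]; lra.
suff [tau taut Htau] : exists2 tau, `|tau| <= 2 * `|t| & phi tau = x 0 i0 + t.
  exists (x ** (tau *: e_ i0)) => //.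
  apply: le_trans (cc_dist_line xr (le_trans taut tr)) _.
  by rewrite lee_fin.
have n0 : `|(0:R)| <= rho1 by rewrite normr0; apply: le_trans tr; rewrite mulr_ge0.
have [t0|t0] := leP 0 t.
- rewrite (ger0_norm t0) in tr *.
  have h0 : 0 <= 2 * t by lra.
  have sl := slope 0 (2 * t) h0 n0; rewrite ger0_norm// in sl.
  have [|c] := @IVT R phi 0 (2 * t) (x 0 i0 + t) h0 (cphi _ _).
    apply/andP; split; first by rewrite ge_min phi0 lerDl t0.
    by rewrite le_max; apply/orP; right; have := sl tr; rewrite phi0; lra.
  by rewrite in_itv /= => /andP[c0 ct] <-; exists c => //; rewrite ger0_norm.
- rewrite (ltr0_norm t0) in tr *.
  have h0 : 2 * t <= 0 by lra.
  have h1 : `|2 * t| <= rho1 by rewrite ler0_norm//; lra.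
  have sl := slope (2 * t) 0 h0 h1 n0.
  have [|c] := @IVT R phi (2 * t) 0 (x 0 i0 + t) h0 (cphi _ _).
    apply/andP; split; last by rewrite le_max phi0; apply/orP; right; lra.
    by rewrite ge_min; apply/orP; left; move: sl; rewrite phi0; lra.
  by rewrite in_itv /= => /andP[c0 ct] <-; exists c => //; rewrite ler0_norm//; lra.
Qed.
End moves.

(** * Points of the line far from a sequence of grids *)

Section grid_set.
Context {R : realType}.
Variable sigma : R.
Hypothesis sigma0 : 0 < sigma.

(** The ratio of successive meshes, 1/(m+8)^2, is negligible with respect to the
    proportion 1/(m+8) that is removed around the grid of mesh m, while the sum
    of these proportions diverges. *)
Fixpoint mesh (m : nat) : R :=
  if m is m'.+1 then mesh m' / (m' + 8)%:R ^+ 2 else sigma.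

Definition far_from_grid (e : nat -> R) (t : R) : Prop :=
  forall m (k : int), e m * mesh m <= `|t - k%:~R * mesh m|.

(** Strict inequalities leave room to enlarge e at finitely many scales; the
    constant 1/4 at fine scales leaves room for any gap sequence that tends to
    0. *)
Definition robust (e : nat -> R) (t : R) : Prop :=
  exists f : nat -> R, [/\ forall m, e m < f m,
    exists N, forall m, (N <= m)%N -> f m = 4^-1 & far_from_grid f t].

Lemma mesh_gt0 m : 0 < mesh m.
Proof. by elim: m => //= m IH; rewrite divr_gt0// exprn_gt0// ltr0n addn_gt0 orbT. Qed.

Lemma mesh_step m : mesh m.+1 * (m + 8)%:R ^+ 2 = mesh m.
Proof. by rewrite /= divfK// expf_neq0// pnatr_eq0 addn_eq0 andbF. Qed.

Lemma mesh_step64 m : mesh m.+1 * 64 <= mesh m.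
Proof.
rewrite -(mesh_step m) ler_wpM2l ?(ltW (mesh_gt0 _))//.
have -> : (64 : R) = 8 ^+ 2 by rewrite -natrX.
by rewrite ler_pXn2r ?nnegrE ?ler0n// ler_nat leq_addl.
Qed.

Lemma mesh_cvg0 (c : R) : 0 < c -> exists m, mesh m < c.
Proof.
move=> c0; exists (Num.bound (sigma / c)); set m := Num.bound _.
have hm : sigma / c < m%:R by apply: archi_boundP; rewrite divr_ge0// ltW.
have H k : mesh k * (k.+1)%:R <= sigma.
  elim: k => [|k IH]; first by rewrite mulr1.
  apply: le_trans IH; apply: (@le_trans _ _ (mesh k.+1 * (64 * k.+1%:R))).
    rewrite ler_wpM2l ?(ltW (mesh_gt0 _))// -natrM ler_nat; lia.
  by rewrite mulrA ler_wpM2r// mesh_step64.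
have := H m; rewrite ltr_pdivrMr// in hm => H1.
have mg := mesh_gt0 m.
rewrite ltNge; apply/negP => cm.
have : sigma < sigma.
  apply: lt_le_trans hm _; apply: le_trans H1; rewrite mulrC.
  apply: ler_pM; rewrite ?ler0n ?(ltW c0)// ler_nat; lia.
by rewrite ltxx.
Qed.

Lemma far_of_between (d c t : R) (j : int) : 0 <= d ->
  j%:~R * d + c <= t -> t + c <= (j + 1)%:~R * d -> forall k : int, c <= `|t - k%:~R * d|.
Proof.
move=> d0 h1 h2 k; have [kj|jk] := leP k j.
  have : k%:~R * d <= j%:~R * d by rewrite ler_wpM2r// ler_int.
  by move=> h; apply: le_trans (ler_norm _); lra.
have : (j + 1)%:~R * d <= k%:~R * d by rewrite ler_wpM2r// ler_int lezD1.
by move=> h; rewrite distrC; apply: le_trans (ler_norm _); lra.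
Qed.

(** The left end of the middle half of the first cell of the grid d Z to the
    right of a. *)
Definition next_cell (d a : R) : R := (Num.ceil (a / d))%:~R * d + d / 4.

Lemma next_cell_ge d a : 0 < d -> a + d / 4 <= next_cell d a.
Proof.
move=> d0; rewrite lerD2r -ler_pdivrMr//; exact: ceil_ge.
Qed.

Lemma next_cell_le d a : 0 < d -> next_cell d a <= a + d + d / 4.
Proof.
move=> d0; rewrite lerD2r.
have : (Num.ceil (a / d))%:~R * d <= (a / d + 1) * d.
  by rewrite ler_pM2r// -lerBlDr ltW//; have := ceilB1_lt (a / d); rewrite intrB.
by rewrite mulrDl divfK ?gt_eqF// mul1r.
Qed.

Lemma next_cell_far d a t : 0 < d -> next_cell d a <= t <= next_cell d a + d / 2 ->
  forall k : int, 4^-1 * d <= `|t - k%:~R * d|.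
Proof.
move=> d0 /andP[h1 h2]; rewrite /next_cell in h1 h2.
apply: (@far_of_between d (4^-1 * d) t (Num.ceil (a / d))); first exact: ltW.
  lra.
by rewrite intrD mulrDl mul1r; lra.
Qed.

(** Nested intervals: the middle half of a cell of the grid of mesh j contains a
    whole cell of the next grid. *)
Lemma exists_far_tail (m : nat) (a : R) : exists t : R,
  next_cell (mesh m) a <= t <= next_cell (mesh m) a + mesh m / 2 /\
  forall j, (m <= j)%N -> forall k : int, 4^-1 * mesh j <= `|t - k%:~R * mesh j|.
Proof.
pose l := fix l i : R := if i is i'.+1 then next_cell (mesh (m + i)) (l i') else next_cell (mesh m) a.
pose D i := mesh (m + i)%N.
have D0 i : 0 < D i by exact: mesh_gt0.
have D64 i : D i.+1 * 64 <= D i by rewrite /D addnS; exact: mesh_step64.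
have lS i : l i.+1 = next_cell (D i.+1) (l i) by [].
have up i : l i <= l i.+1.
  by rewrite lS; have := next_cell_ge (l i) (D0 i.+1); have := D0 i.+1; lra.
have down i : l i.+1 + D i.+1 / 2 <= l i + D i / 2.
  by rewrite lS; have := next_cell_le (l i) (D0 i.+1); have := D64 i; have := D0 i.+1; lra.
have lup i j : (i <= j)%N -> l i <= l j.
  by move=> ij; apply: (homo_leq (r := fun x y => x <= y)) ij => // y x z; exact: le_trans.
have ldown i j : (i <= j)%N -> l j + D j / 2 <= l i + D i / 2.
  move=> ij; apply: (homo_leq (f := fun i => l i + D i / 2) (r := fun x y => y <= x)) ij => //.
  by move=> y x z h1 h2; exact: le_trans h2 h1.
have lub i j : l i <= l j + D j / 2.
  have [ij|ji] := leqP i j.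
    by apply: le_trans (lup _ _ ij) _; have := D0 j; lra.
  by apply: le_trans (ldown _ _ (ltnW ji)); have := D0 i; lra.
have hs : has_sup (range l).
  by split; [exists (l 0%N), 0%N | exists (l 0%N + D 0%N / 2) => _ [i _ <-]].
have supl i : l i <= sup (range l) by apply: ub_le_sup; [exact: hs.2 | exists i].
have supu i : sup (range l) <= l i + D i / 2.
  by apply: ge_sup; [exact: hs.1 | move=> _ [j _ <-]].
exists (sup (range l)); split.
  by have := supl 0%N; have := supu 0%N; rewrite /D addn0 /= => -> ->.
move=> j mj; have -> : j = (m + (j - m))%N by rewrite subnKC.
case: (j - m)%N => [|i].
  apply: (@next_cell_far _ a); first exact: mesh_gt0.
  by have := supl 0%N; have := supu 0%N; rewrite /D addn0 /= => -> ->.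
apply: (@next_cell_far _ (l i)); first exact: mesh_gt0.
by rewrite -/(D i.+1) -lS supl supu.
Qed.

End grid_set.

Section robust_points.
Context {R : realType}.
Variable sigma : R.
Hypothesis sigma0 : 0 < sigma.
Local Notation mesh := (mesh sigma).
Local Notation far := (far_from_grid sigma).
Local Notation robust := (robust sigma).
Let mgt0 := mesh_gt0 sigma0.

Lemma floor_cell (d t : R) : 0 < d ->
  (Num.floor (t / d))%:~R * d <= t < (Num.floor (t / d) + 1)%:~R * d.
Proof.
move=> d0; rewrite -ler_pdivlMr// -ltr_pdivrMr// floor_le_tmp.
by rewrite floorD1_gt.
Qed.

Lemma far_le1 e t m : far e t -> e m <= 1.
Proof.
move=> /(_ m (Num.floor (t / mesh m))); have := floor_cell t (mgt0 m).
set k := Num.floor _; rewrite intrD mulrDl mul1r => /andP[h1 h2].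
rewrite ger0_norm ?subr_ge0// => h3.
by rewrite -(ler_pM2r (mgt0 m)) mul1r; lra.
Qed.

(** Step aside from x away from the nearest grid point. *)
Lemma window_off_grid (d x be : R) : 0 < be -> be <= d ->
  exists p, [/\ x - be / 4 <= p, p + be / 8 <= x + be / 4 &
    forall z, p <= z <= p + be / 8 -> forall k : int, be / 8 <= `|z - k%:~R * d|].
Proof.
move=> be0 bed; have d0 : 0 < d by exact: lt_le_trans bed.
have := floor_cell x d0; set kap := Num.floor _ => /andP[kx xk].
have kap1 : (kap + 1)%:~R * d = kap%:~R * d + d by rewrite intrD mulrDl mul1r.
have [xm|xm] := leP x (kap%:~R * d + d / 2).
  exists (x + be / 8); split; [lra | lra | move=> z /andP[z1 z2]].
  by apply: (far_of_between (ltW d0) (j := kap)); rewrite ?kap1; lra.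
exists (x - be / 4); split; [lra | lra | move=> z /andP[z1 z2]].
by apply: (far_of_between (ltW d0) (j := kap)); rewrite ?kap1; lra.
Qed.

(** Non-porosity at a of the set of points far from the grids with gaps e.  Let n
    be the first scale where 2 h is no less than (e'_n - e_n) delta_n.  The
    coarser grids are too far from a to matter within distance 2 h.  At the
    scale n the gap e_n delta_n is a small fraction of lam h, so near x there is
    a window off the grid, of length comparable to the smaller of lam h and
    delta_n; it contains many cells of the next grid, hence a point that is far
    from all the finer grids. *)
Lemma robust_near (e e' : nat -> R) (a lam : R) : (forall m, 0 < e m) ->
  (forall m, e m < e' m) -> (forall m, (m + 8)%:R^-1 <= e' m) ->
  (forall c : R, 0 < c -> exists N, forall m, (N <= m)%N -> e m <= c * e' m) ->
  far e' a -> 0 < lam -> lam <= 1 ->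
  exists2 eta : R, 0 < eta & forall x h, 0 < h -> h < eta -> `|x - a| <= h ->
    exists2 z, `|z - x| < lam * h & robust e z.
Proof.
move=> e0 ee' e'8 e'e fa lam0 lam1.
pose g m := (e' m - e m) * mesh m.
have g0 m : 0 < g m by rewrite mulr_gt0// subr_gt0.
have [N1 HN1] := e'e (lam / 64) ltac:(lra).
pose N2 := Num.bound (64 / lam).
have HN2 m : (N2 <= m)%N -> 64 <= lam * (m + 8)%:R.
  move=> Nm; rewrite -ler_pdivrMl// mulrC; apply: (@le_trans _ _ N2%:R).
    by apply/ltW/archi_boundP; rewrite divr_ge0// ltW.
  by rewrite ler_nat; lia.
pose N := maxn N1 N2.
have [eta eta0 Heta] : exists2 eta : R, 0 < eta & forall m, (m < N)%N -> 2 * eta <= g m.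
  elim: N => [|M [eta eta0 H]]; first by exists 1.
  exists (Num.min eta (g M / 2)); first by rewrite lt_min eta0 divr_gt0.
  move=> m; rewrite ltnS leq_eqVlt => /orP[/eqP->|/H mM].
    have : Num.min eta (g M / 2) <= g M / 2 by rewrite ge_min lexx orbT.
    lra.
  have : Num.min eta (g M / 2) <= eta by rewrite ge_min lexx.
  lra.
exists eta => // x h h0 heta xah.
have exn : exists m, g m <= 2 * h.
  have h20 : 0 < 2 * h by lra.
  have [m mh] := mesh_cvg0 sigma0 h20; exists m; apply: le_trans (ltW mh).
  rewrite -[leRHS]mul1r ler_wpM2r ?(ltW (mgt0 _))//.
  by have := far_le1 m fa; have := e0 m; lra.
have [n gn nmin] := ex_minnP exn.
have Nn : (N <= n)%N.
  by rewrite leqNgt; apply/negP => /Heta; lra.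
(* The constant 64 is chosen so that the gap e n * mesh n and two cells of
   the next grid are each at most be / 8, for the be defined below. *)
have eN1 m : (n <= m)%N -> e m <= lam / 64 * e' m.
  by move=> nm; apply: HN1; exact: leq_trans (leq_maxl _ _) (leq_trans Nn nm).
have e'1 m := far_le1 m fa.
pose w := lam * h.
have w0 : 0 < w by rewrite mulr_gt0.
have wh : w <= h by rewrite /w -[leRHS]mul1r ler_wpM2r// ltW.
have D0 := mgt0 n; have D'0 := mgt0 n.+1.
have D64 := mesh_step64 sigma0 n.
pose A := e n * mesh n; pose B := e' n * mesh n.
have AB : A <= lam / 64 * B by rewrite /A /B mulrA ler_wpM2r ?(ltW D0)// eN1.
have B0 : 0 < B by rewrite mulr_gt0// (lt_trans (e0 n)).
have BD : B <= mesh n by rewrite -[leRHS]mul1r ler_wpM2r// (ltW D0).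
have lB : lam * B <= B by rewrite -[leRHS]mul1r ler_wpM2r// (ltW B0).
have Bh : B <= 4 * h.
  have : g n = B - A by rewrite /g mulrBl.
  lra.
have lBw : lam * B <= 4 * w by rewrite /w [leRHS]mulrCA ler_wpM2l// (ltW lam0).
have D'B : mesh n.+1 * 64 <= lam * B.
  have h1 : 64 <= lam * (n + 8)%:R by apply: HN2; exact: leq_trans (leq_maxr _ _) Nn.
  apply: le_trans (ler_wpM2l (ltW D'0) h1) _.
  rewrite mulrCA; apply: ler_wpM2l; first exact: ltW.
  have n8 : 0 < (n + 8)%:R :> R by rewrite ltr0n addn_gt0 orbT.
  rewrite /B -(mesh_step sigma n) [leRHS]mulrCA; apply: ler_wpM2l; first exact: ltW.
  rewrite expr2 mulrA; apply: ler_peMl; first exact: ltW.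
  by rewrite -ler_pdivrMr// mul1r e'8.
pose be := Num.min w (mesh n).
have be0 : 0 < be by rewrite lt_min w0.
have bew : be <= w by rewrite ge_min lexx.
have beD : be <= mesh n by rewrite ge_min lexx orbT.
have Abe : A < be / 8.
  by rewrite ltr_pdivlMr// lt_min; apply/andP; split; lra.
have D'be : mesh n.+1 * 2 <= be / 8.
  by rewrite ler_pdivlMr// le_min; apply/andP; split; lra.
have [p [px1 px2 Hp]] := window_off_grid x be0 beD.
have [z [/andP[z1 z2] zfar]] := exists_far_tail sigma0 n.+1 p.
have pz := le_trans (next_cell_ge p D'0) z1.
have zp2 := le_trans z2 (lerD (next_cell_le p D'0) (lexx _)).
have zp : p <= z <= p + be / 8.
  by move: pz zp2 D'be D'0; clear; move=> *; apply/andP; split; lra.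
have zx : `|z - x| <= be / 4.
  by case/andP: zp px1 px2; clear; move=> *; apply/ler_normlP; split; lra.
have zw : `|z - x| < w by apply: le_lt_trans zx _; move: bew w0; clear; lra.
exists z; first exact: zw.
have za : `|z - a| <= 2 * h.
  by have := ler_distD x z a; move: zw wh xah; clear; lra.
(* The new gaps: what is left of e' at a distance 2 h from a, then the
   distance of the window to the grid n, then the constant 1/4. *)
pose f m := if (m < n)%N then e' m - 2 * h / mesh m else if m == n then be / (8 * mesh n) else 4^-1.
exists f; split.
- move=> m; rewrite /f; case: (ltngtP m n) => [mn|mn|->].
  + have gm : 2 * h < g m by rewrite ltNge; apply/negP => /nmin; rewrite leqNgt mn.
    by rewrite ltrBrDr addrC -ltrBrDr ltr_pdivrMr ?mgt0.
  + have := eN1 m (ltnW mn); have := e'1 m; have := e0 m.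
    have : lam * e' m <= e' m by rewrite ler_piMl// ltW// (lt_trans (e0 m)).
    lra.
  + rewrite ltr_pdivlMr ?mulr_gt0// mulrCA.
    by move: Abe; rewrite -/A; lra.
- by exists n.+1 => m nm; rewrite /f ltnNge (ltnW nm) /= gtn_eqF.
- move=> m k; rewrite /f; case: (ltngtP m n) => [mn|mn|->].
  + rewrite mulrBl divfK ?gt_eqF//.
    have := fa m k; have := ler_distD z a (k%:~R * mesh m).
    rewrite [`|a - z|]distrC; lra.
  + exact: zfar.
  + by rewrite invfM mulrA divfK ?gt_eqF//; exact: Hp.
Qed.

(** The lower bound keeps the gaps large with respect to the next mesh; the
    convergence to 0 makes room for larger admissible gaps. *)
Definition admissible (e : nat -> R) : Prop :=
  (forall m, (m + 8)%:R^-1 <= e m) /\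
  (forall c : R, 0 < c -> exists N, forall m, (N <= m)%N -> e m <= c).

Lemma admissible_gt0 e m : admissible e -> 0 < e m.
Proof. by move=> [/(_ m) h _]; apply: lt_le_trans h; rewrite invr_gt0 ltr0n addn_gt0 orbT. Qed.

Lemma robust_far e t : robust e t -> far e t.
Proof.
move=> [f [ef _ ff]] m k; apply: le_trans (ff m k).
by rewrite ler_wpM2r ?(ltW (mgt0 _))// ltW.
Qed.

Lemma far_mono e e' t : (forall m, e m <= e' m) -> far e' t -> far e t.
Proof.
move=> ee' ft m k; apply: le_trans (ft m k).
by rewrite ler_wpM2r ?(ltW (mgt0 _)).
Qed.

(** At coarse scales take the mean of e and of the gaps witnessing robustness; at
    fine scales take the square root of e, which is still less than 1/4. *)
Lemma robust_refine e t : admissible e -> robust e t -> exists e', [/\ admissible e',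
  (forall m, e m < e' m),
  (forall c : R, 0 < c -> exists N, forall m, (N <= m)%N -> e m <= c * e' m) & robust e' t].
Proof.
move=> ae [f [ef [N HN] ff]].
have e0 m := admissible_gt0 m ae.
have [e8 ecvg] := ae.
have sqb c m : 0 < c -> e m <= c ^+ 2 -> Num.sqrt (e m) <= c.
  by move=> c0 h; rewrite -[leRHS](ger0_norm (ltW c0)) -sqrtr_sqr ler_wsqrtr.
have [M HM] := ecvg (8^-1 ^+ 2) ltac:(by rewrite exprn_gt0).
pose N1 := maxn N M.
have s8 m : (N1 <= m)%N -> Num.sqrt (e m) <= 8^-1.
  by move=> h; apply: sqb => //; apply: HM; move: h; rewrite /N1; lia.
have s0 m : 0 < Num.sqrt (e m) by rewrite sqrtr_gt0.
have ss m : e m = Num.sqrt (e m) * Num.sqrt (e m) by rewrite -expr2 sqr_sqrtr// ltW.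
pose e' m := if (m < N1)%N then (e m + f m) / 2 else Num.sqrt (e m).
have ee' m : e m < e' m.
  rewrite /e'; case: ltnP => [_|h]; first by have := ef m; lra.
  rewrite [ltLHS]ss -[ltRHS]mulr1 ltr_pM2l//.
  by apply: le_lt_trans (s8 m h) _; lra.
exists e'; split => //.
- split; first by move=> m; apply: le_trans (e8 m) (ltW (ee' m)).
  move=> c c0; have [M' HM'] := ecvg (c ^+ 2) ltac:(by rewrite exprn_gt0).
  exists (maxn N1 M') => m h; rewrite /e' ltnNge; have -> : (N1 <= m)%N by lia.
  by apply: sqb => //; apply: HM'; lia.
- move=> c c0; have [M' HM'] := ecvg (c ^+ 2) ltac:(by rewrite exprn_gt0).
  exists (maxn N1 M') => m h; rewrite /e' ltnNge; have -> /= : (N1 <= m)%N by lia.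
  rewrite [leLHS]ss ler_wpM2r ?(ltW (s0 _))//.
  by apply: sqb => //; apply: HM'; lia.
- exists f; split => //; last by exists N.
  move=> m; rewrite /e'; case: ltnP => [_|h]; first by have := ef m; lra.
  have -> : f m = 4^-1 by apply: HN; move: h; rewrite /N1; lia.
  by apply: le_lt_trans (s8 m h) _; lra.
Qed.

Definition base_gap (m : nat) : R := (m + 8)%:R^-1.

Lemma base_admissible : admissible base_gap.
Proof.
split => // c c0; exists (Num.bound c^-1) => m h; rewrite /base_gap.
have i0 : 0 < c^-1 by rewrite invr_gt0.
rewrite -[leRHS]invrK lef_pV2 ?posrE// ?ltr0n ?addn_gt0 ?orbT//.
apply: ltW; apply: lt_le_trans (archi_boundP (ltW i0)) _.
by rewrite ler_nat; lia.
Qed.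

Lemma base_robust : exists2 t, robust base_gap t & 0 < t < sigma.
Proof.
have [t [/andP[t1 t2] tf]] := exists_far_tail sigma0 0 0.
have c0 : next_cell (mesh 0) 0 = sigma / 4.
  by rewrite /next_cell mul0r ceil0 mul0r add0r.
exists t; last by rewrite c0 /= in t1 t2; have s0 := sigma0; apply/andP; split; lra.
exists (fun=> 4^-1); split; [|by exists 0%N|by move=> m k; exact: tf].
move=> m; rewrite /base_gap ltf_pV2 ?posrE ?ltr0n// ?addn_gt0 ?orbT// ltr_nat; lia.
Qed.

Lemma cell_split (lo d x : R) (N : nat) : 0 < d -> lo <= x <= lo + N%:R * d -> (0 < N)%N ->
  exists2 i, (i < N)%N & lo + i%:R * d <= x <= lo + i.+1%:R * d.
Proof.
move=> d0 /andP[lox]; elim: N => // N IH xN _.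
have [h|h] := leP x (lo + N%:R * d); last by exists N => //; rewrite ltW//=.
case: N IH h xN => [_ h xN|N IH h _].
  by exists 0%N => //; rewrite mul0r addr0 lox /=; move: h; rewrite mul0r; lra.
by have [i iN Hi] := IH h isT; exists i => //; exact: ltnW.
Qed.

(** A cell of mesh N loses the first and the last N + 8 of its (N + 8)^2 subcells,
    so the total length is multiplied by 1 - 2/(N + 8), which is less than
    (N + 7)/(N + 8); the product of these factors telescopes. *)
Lemma far_cover (N : nat) : exists l : seq nat,
  (forall t, 0 <= t <= sigma -> far base_gap t ->
     exists2 k, k \in l & k%:R * mesh N <= t <= k.+1%:R * mesh N) /\
  (size l)%:R * mesh N * (N + 7)%:R <= 7 * sigma.
Proof.
elim: N => [|N [l [lcov lsize]]].
  exists [:: 0%N]; split; last by rewrite /= mul1r mulrC.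
  by move=> t t01 _; exists 0%N; rewrite ?inE// mul0r mul1r.
pose w := (N + 8)%N; pose q := (w ^ 2)%N.
exists [seq (k * q + d)%N | k <- l, d <- iota w (q - 2 * w)].
have qw : (2 * w < q)%N by rewrite /q /w; nia.
have md : mesh N = q%:R * mesh N.+1 by rewrite -(mesh_step sigma N) /q natrX mulrC.
have d0 := mgt0 N.+1.
split.
- move=> t t01 ft; have [k kl /andP[kt tk]] := lcov t t01 ft.
  have gap : base_gap N * mesh N = w%:R * mesh N.+1.
    rewrite md /base_gap -/w /q natrX expr2 !mulrA mulVf ?mul1r//.
    by rewrite pnatr_eq0 /w addn_eq0 andbF.
  have f1 := ft N (Posz k); have f2 := ft N (Posz k.+1).
  rewrite gap -!pmulrn in f1 f2.
  rewrite ger0_norm ?subr_ge0// in f1; rewrite ler0_norm ?subr_le0// opprB in f2.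
  have [|||i iq Hi] := @cell_split ((k * q + w)%:R * mesh N.+1) (mesh N.+1) t (q - 2 * w).
  + exact: d0.
  + apply/andP; split.
      rewrite natrD mulrDl natrM -mulrA -md; lra.
    rewrite -mulrDl -natrD.
    have -> : (k * q + w + (q - 2 * w) = k.+1 * q - w)%N by clear -qw; lia.
    rewrite natrB; last by clear -qw; nia.
    rewrite mulrBl natrM -mulrA -md; lra.
  + by rewrite subn_gt0.
  exists (k * q + (w + i))%N.
    apply/allpairsP; exists (k, (w + i)%N); split => //=.
    by rewrite mem_iota leq_addr ltn_add2l.
  move: Hi; rewrite -!mulrDl -!natrD addnA.
  by have -> : (k * q + w + i.+1 = (k * q + w + i).+1)%N by rewrite addnS.
- rewrite size_allpairs size_iota.
  apply: le_trans lsize; rewrite md natrM.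
  have le_nat : ((q - 2 * w) * (N.+1 + 7) <= q * (N + 7))%N.
    by rewrite /q /w; nia.
  have -> : (size l)%:R * (q - 2 * w)%:R * mesh N.+1 * (N.+1 + 7)%:R =
      (size l)%:R * mesh N.+1 * ((q - 2 * w) * (N.+1 + 7))%:R by rewrite !natrM; ring.
  have -> : (size l)%:R * (q%:R * mesh N.+1) * (N + 7)%:R =
      (size l)%:R * mesh N.+1 * (q * (N + 7))%:R by rewrite !natrM; ring.
  by rewrite ler_wpM2l ?ler_nat// mulr_ge0// ltW.
Qed.

Lemma far_closed e : closed [set t | far e t].
Proof.
rewrite (_ : [set t | far e t] = \bigcap_m \bigcap_(k in [set: int]) [set t : R | e m * mesh m <= `|t - k%:~R * mesh m|]).
  apply: closed_bigI => m _; apply: closed_bigI => k _.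
  apply: (@closed_comp _ _ (fun t : R => `|t - k%:~R * mesh m|) [set y | e m * mesh m <= y]); last exact: closed_ge.
  move=> t _; apply: (@continuous_comp _ _ _ (fun t : R => t - k%:~R * mesh m) Num.Def.normr); last exact: norm_continuous.
  by apply: cvgB; [exact: cvg_id | exact: cvg_cst].
apply/seteqP; split => t h; first by move=> m _ k _; exact: h.
by move=> m k; exact: h.
Qed.

Lemma far_gap e t (d : R) : (forall m, 0 < e m) -> 0 < d -> exists2 z, `|z - t| < d & ~ far e z.
Proof.
move=> e0 d0; have [m md] := mesh_cvg0 sigma0 d0.
have /andP[h1 h2] := floor_cell t (mgt0 m).
exists ((Num.floor (t / mesh m))%:~R * mesh m).
  rewrite distrC ger0_norm ?subr_ge0//; move: h2; rewrite intrD mulrDl mul1r; lra.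
move=> /(_ m (Num.floor (t / mesh m))); rewrite subrr normr0.
by rewrite leNgt mulr_gt0.
Qed.

End robust_points.

(** * The slab over the null set *)

Section slab.
Context {R : realType} {n : nat}.
Local Notation E := 'rV[R]_n.
Variables (sigma : R) (i0 : 'I_n).
Hypothesis sigma0 : 0 < sigma.

Definition slab : set E := [set x | [/\ forall i, `|x 0 i| <= 1, 0 <= x 0 i0 <= sigma &
  far_from_grid sigma base_gap (x 0 i0)]].

Lemma slab_closed : closed slab.
Proof.
have -> : slab = (\bigcap_(i in [set: 'I_n]) [set x : E | `|x 0 i| <= 1]) `&`
   ((fun x : E => x 0 i0) @^-1` ([set t | 0 <= t] `&` [set t | t <= sigma] `&` [set t | far_from_grid sigma base_gap t])).
  apply/seteqP; split => x.
    by move=> [h1 /andP[h2 h3] h4]; split => // i _; exact: h1.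
  by move=> [h1 [[h2 h3] h4]]; split => [i||//]; [exact: h1 | apply/andP].
apply: closedI.
  apply: closed_bigI => i _.
  apply: (@closed_comp _ _ (fun x : E => `|x 0 i|) [set y | y <= 1]); last exact: closed_le.
  move=> x _; apply: (@continuous_comp _ _ _ (fun x : E => x 0 i) Num.Def.normr); last exact: norm_continuous.
  exact: coord_continuous.
apply: closed_comp => [x _|]; first exact: coord_continuous.
apply: closedI; last exact: far_closed.
by apply: closedI; [exact: closed_ge | exact: closed_le].
Qed.

Lemma slab_nowhere_dense : nowhere_dense slab.
Proof.
rewrite /nowhere_dense -(closure_id _).1; last exact: slab_closed.
rewrite -subset0 => x /nbhs_normP[d /= d0 Hd].
have b0 (m : nat) : 0 < base_gap m :> R by rewrite /base_gap invr_gt0 ltr0n addn_gt0 orbT.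
have [z zx nz] := far_gap sigma0 (x 0 i0) b0 d0.
apply: nz; have -> : z = (x + (z - x 0 i0) *: delta_mx 0 i0) 0 i0.
  by rewrite !mxE !eqxx mulr1 subrKC.
suff [] : slab (x + (z - x 0 i0) *: delta_mx 0 i0) by [].
apply: Hd; rewrite /ball_ /= opprD addrA subrr sub0r normrN normrZ.
apply: le_lt_trans zx; rewrite -[leRHS]mulr1 ler_wpM2l//.
apply: normr_le_coord => // j; rewrite mxE.
by case: (_ && _); rewrite ?normr1 ?normr0.
Qed.

Lemma sum_finite_eq (c : R) (K M : nat) :
  \sum_(k < M) (if (k < K)%N then c else 0) = (minn M K)%:R * c.
Proof.
elim: M => [|M IH]; first by rewrite big_ord0 min0n mul0r.
rewrite big_ord_recr /= IH; case: ltnP => h.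
  by rewrite (minn_idPl h) -natr1 mulrDl mul1r.
by rewrite addr0 (minn_idPr (leqW h)).
Qed.

(** The boxes over the intervals of [far_cover]; the sequence of boxes is
    completed by degenerate ones. *)
Lemma slab_null : lebesgue_outer slab = 0%E.
Proof.
apply/eqP; rewrite eq_le; apply/andP; split; last first.
  apply: le_ereal_inf_tmp => _ [a [b [ab _ ->]]].
  by apply: nneseries_ge0 => k _ _; rewrite lee_fin prodr_ge0// => i _; rewrite subr_ge0.
apply/lee_addgt0Pr => e e0; rewrite add0e.
pose C : R := \prod_(i < n | i != i0) 2.
have C0 : 0 < C by apply: prodr_gt0.
pose N := Num.bound (7 * sigma * C / e).
have [l [lcov lsize]] := far_cover sigma0 N.
have NE : 7 * sigma * C < N%:R * e.
  rewrite -ltr_pdivrMr//; apply: archi_boundP.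
  by rewrite divr_ge0 ?mulr_ge0// ltW.
have N7 : 0 < (N + 7)%:R :> R by rewrite ltr0n addn_gt0 orbT.
set D := mesh sigma N in lcov lsize.
have D0 : 0 < D := mesh_gt0 sigma0 N.
have small : (size l)%:R * (D * C) <= e.
  rewrite -(ler_pM2r N7); apply: (@le_trans _ _ (7 * sigma * C)).
    have -> : (size l)%:R * (D * C) * (N + 7)%:R = (size l)%:R * D * (N + 7)%:R * C by ring.
    by rewrite ler_wpM2r// ltW.
  apply: le_trans (ltW NE) _; rewrite mulrC ler_wpM2l ?(ltW e0)// ler_nat.
  exact: leq_addr.
pose a k : E := \row_i (if (k < size l)%N then if i == i0 then (nth 0%N l k)%:R * D else -1 else 0).
pose b k : E := \row_i (if (k < size l)%N then if i == i0 then (nth 0%N l k).+1%:R * D else 1 else 0).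
have bak k : \prod_(i < n) (b k 0 i - a k 0 i) = if (k < size l)%N then D * C else 0.
  rewrite (bigD1 i0)//= !mxE eqxx; case: ifP => kl; last by rewrite subrr mul0r.
  rewrite -mulrBl -natrB ?leqW// subSnn mul1r; congr (_ * _).
  apply: eq_bigr => i ii; rewrite !mxE kl (negbTE ii) opprK.
  by rewrite -[1 + 1]/(2 : R).
apply: (@le_trans _ _ (\sum_(k <oo) (\prod_(i < n) (b k 0 i - a k 0 i))%:E)%E).
  apply: ereal_inf_lbound; exists a, b; split => //.
    move=> k i; rewrite !mxE; case: ifP => // _; case: ifP => _; last by lra.
    by rewrite ler_wpM2r ?(ltW D0)// ler_nat.
  move=> x [x1 xs xf]; have [k kl Hk] := lcov _ xs xf.
  exists (index k l) => // i; rewrite !mxE index_mem kl nth_index//.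
  have [->|_] := eqVneq i i0; first exact: Hk.
  by have := x1 i; rewrite ler_norml.
apply: lime_le.
  by apply: is_cvg_nneseries => k _ _; rewrite bak lee_fin; case: ifP => // _; rewrite mulr_ge0 ?ltW.
apply: nearW => M; rewrite big_mkord sumEFin lee_fin.
under eq_bigr do rewrite bak.
rewrite sum_finite_eq; apply: le_trans small; apply: ler_wpM2r.
  by rewrite mulr_ge0// ltW.
by rewrite ler_nat geq_minr.
Qed.
End slab.

(** * The Baire category argument *)

(** The hypotheses on [dist] are those properties of the Carnot-Caratheodory
    distance near 0 that the argument uses. *)
Section baire.
Context {R : realType} {n : nat}.
Local Notation E := 'rV[R]_n.
Variables (dist : E -> E -> \bar R) (i0 : 'I_n) (C eta0 sigma : R).
Hypothesis sigma0 : 0 < sigma.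
Hypothesis C1 : 1 <= C.
Hypothesis eta00 : 0 < eta0.
Hypothesis dist_ge0 : forall x y, (0 <= dist x y)%E.
Hypothesis dist_refl : forall x, dist x x = 0%E.
Hypothesis dist_sym : forall x y, dist x y = dist y x.
Hypothesis dist_norm : forall (x y : E) (r : R), `|x| <= eta0 -> C * r <= eta0 ->
  (dist x y < r%:E)%E -> `|y - x| <= C * r.
Hypothesis dist_tri : forall (x y z : E) (r1 r2 : R),
  `|x| <= eta0 -> `|y| <= eta0 -> `|z| <= eta0 -> C * r1 <= eta0 -> C * r2 <= eta0 ->
  (dist x y < r1%:E)%E -> (dist y z < r2%:E)%E -> (dist x z < (r1 + r2)%:E)%E.
Hypothesis dist_move : forall (x : E) (t : R), `|x| <= eta0 -> 2 * `|t| <= eta0 ->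
  exists2 y : E, y 0 i0 = x 0 i0 + t & (dist x y <= (2 * `|t|)%:E)%E.

Hypothesis dist_complete : forall (x : nat -> E) (r : nat -> R),
  (forall k, `|x k| <= eta0) -> (forall k, 0 < r k) -> (forall k, r k.+1 <= r k / 4) ->
  C * r 0%N <= eta0 -> (forall k, (dist (x k) (x k.+1) < (r k / 2)%:E)%E) ->
  exists2 xoo : E, x k @[k --> \oo] --> xoo & forall k, (dist (x k) xoo < (r k)%:E)%E.

Let C0 : 0 < C. Proof. exact: lt_le_trans C1. Qed.

(** Porosity of a set at a point would be automatic if the distance vanished
    somewhere off the diagonal, because balls of radius 0 are empty. *)
Lemma dist_gt0 x y : `|x| <= eta0 -> x <> y -> (0 < dist x y)%E.
Proof.
move=> xe xy; rewrite lt_def dist_ge0 andbT; apply/eqP => d0; apply: xy.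
apply/eqP; rewrite eq_sym -subr_eq0 -normr_eq0 eq_le normr_ge0 andbT.
apply/ler_addgt0Pr => e e0; rewrite add0r.
pose r := Num.min e eta0 / C.
have Cr : C * r = Num.min e eta0 by rewrite /r mulrCA mulfV ?mulr1// gt_eqF.
apply: (@le_trans _ _ (C * r)); last by rewrite Cr ge_min lexx.
apply: dist_norm => //; first by rewrite Cr ge_min lexx orbT.
by rewrite d0 lte_fin divr_gt0// lt_min e0.
Qed.

(** Lift of [robust_near]: moving c along the axis corrects its coordinate. *)
Lemma robust_preimage_near (e e' : nat -> R) (a : E) (lam : R) :
  admissible e -> admissible e' -> (forall m, e m < e' m) ->
  (forall c : R, 0 < c -> exists N, forall m, (N <= m)%N -> e m <= c * e' m) ->
  `|a| <= eta0 / 2 -> far_from_grid sigma e' (a 0 i0) -> 0 < lam -> lam < 1 ->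
  exists2 del : R, 0 < del & forall (c : E) (r : R), dist c a = r%:E -> 0 < r -> r < del ->
    exists y : E, [/\ robust sigma e (y 0 i0), `|c| <= eta0 /\ `|y| <= 3 / 4 * eta0,
      C * r <= eta0 / 16, (dist c y < (lam * r / 2)%:E)%E & (dist a y < (3 * r)%:E)%E].
Proof.
move=> ae ae' ee' ee'0 an fa lam0 lam1.
have C_ge1 := C1; have eta_gt0 := eta00; have C_gt0 := C0.
pose lam' := lam / (8 * C).
have lam'0 : 0 < lam' by rewrite divr_gt0// mulr_gt0.
have lam'1 : lam' <= 1 by rewrite ler_pdivrMr ?mulr_gt0// mul1r; lra.
have [eta eta_0 Hnear] :=
  robust_near sigma0 (fun m => admissible_gt0 m ae) ee' (ae'.1) ee'0 fa lam'0 lam'1.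
exists (Num.min (eta / (2 * C)) (eta0 / (16 * C))).
  by rewrite !lt_min !divr_gt0// mulr_gt0.
move=> c r cr r0; rewrite lt_min !ltr_pdivlMr ?mulr_gt0// => /andP[r_eta r_eta0].
have Cr0 : 0 < C * r by rewrite mulr_gt0.
have rC : r <= C * r by rewrite ler_peMl// ltW.
have ac : dist a c = r%:E by rewrite dist_sym.
have ca : `|c - a| <= C * (2 * r) by apply: dist_norm; rewrite ?ac ?lte_fin; lra.
have cn : `|c| <= 5 / 8 * eta0 by have := ler_normD (c - a) a; rewrite subrK; lra.
have h0 : 0 < 2 * C * r by rewrite !mulr_gt0.
have heta : 2 * C * r < eta by rewrite mulrC.
have ch : `|c 0 i0 - a 0 i0| <= 2 * C * r.
  by have := le_trans (normr_coord _ i0) ca; rewrite !mxE; lra.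
have [q qc rq] := Hnear _ _ h0 heta ch.
have lamE : lam' * (2 * C * r) = lam * r / 4 by rewrite /lam'; field; rewrite gt_eqF.
rewrite lamE in qc.
have lamr : lam * r <= r by rewrite ler_piMl ?ltW.
have lr0 : 0 < lam * r by rewrite mulr_gt0.
have Clr : C * (lam * r) <= C * r by apply: ler_wpM2l lamr; exact: ltW.
have cn' : `|c| <= eta0 by lra.
have [|y yi yd] := dist_move (t := q - c 0 i0) cn'; first lra.
have cy : (dist c y < (lam * r / 2)%:E)%E.
  by apply: le_lt_trans yd _; rewrite lte_fin; lra.
have yc : `|y - c| <= C * (lam * r / 2) by apply: dist_norm cy => //; lra.
have yn : `|y| <= 3 / 4 * eta0 by have := ler_normD (y - c) c; rewrite subrK; lra.
exists y; split => //; first by rewrite yi subrKC.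
  by lra.
have ay : (dist a y < (2 * r + lam * r / 2)%:E)%E.
  by apply: (dist_tri (y := c)) cy; rewrite ?ac ?lte_fin; lra.
by apply: lt_le_trans ay _; rewrite lee_fin; lra.
Qed.

(** The last condition keeps all later points in the ball where the local
    properties of the distance hold. *)
Definition stage_ok (e : nat -> R) (x : E) (r : R) : Prop :=
  [/\ admissible e, robust sigma e (x 0 i0), 0 < r & `|x| + C * r <= eta0 / 2].

(** Either a small ball around a robust point misses P, and one moves there; or P
    accumulates at all robust points nearby, and then the refined gaps e' work:
    if a point a of P were far from the grids with gaps e', a hole of P near a
    would contain a robust point, hence a point of P. *)
Lemma escape_porous (P : set E) (e : nat -> R) (x : E) (r : R) :
  porous dist P -> stage_ok e x r ->
  exists e' x' r', stage_ok e' x' r' /\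
  [/\ forall m, e m <= e' m, r' <= r / 4, (dist x x' < (r / 2)%:E)%E &
      forall a : E, far_from_grid sigma e' (a 0 i0) -> (dist x' a < r'%:E)%E -> ~ P a].
Proof.
move=> [lam [lam0 lam1 Plam]] [ae re r0 xr].
have C_ge1 := C1; have eta_gt0 := eta00; have C_gt0 := C0.
have Cr0 : 0 < C * r by rewrite mulr_gt0.
have x0 := normr_ge0 x.
have [[y [d [d0 xy ry yP]]]|noA] := pselect (exists y (d : R),
   [/\ 0 < d, (dist x y < (r / 2)%:E)%E, robust sigma e (y 0 i0) &
       forall p, P p -> ~ (dist y p < d%:E)%E]).
  exists e, y, (Num.min (r / 4) d).
  have r'4 : Num.min (r / 4) d <= r / 4 by rewrite ge_min lexx.
  split; split => //.
  - by rewrite lt_min d0 andbT divr_gt0.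
  - have yx : `|y - x| <= C * (r / 2) by apply: dist_norm xy; lra.
    have : C * Num.min (r / 4) d <= C * (r / 4) by apply: ler_wpM2l => //; exact: ltW.
    have := ler_normD (y - x) x; rewrite subrK; lra.
  - move=> a _ ya Pa; apply: (yP a Pa); apply: lt_le_trans ya _.
    by rewrite lee_fin ge_min lexx orbT.
have [e' [ae' ee' ee'0 re']] := robust_refine ae re.
exists e', x, (r / 4); split; first split => //; first by rewrite divr_gt0.
  by lra.
split => //; first by move=> m; exact/ltW.
  by rewrite dist_refl lte_fin divr_gt0.
move=> a fa xa Pa.
have ax : `|a - x| <= C * (r / 4) by apply: dist_norm xa; lra.
have an : `|a| <= eta0 / 2 by have := ler_normD (a - x) x; rewrite subrK; lra.
have [z [za zcvg zP]] := Plam a Pa.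
have [del del0 Hdel] := robust_preimage_near ae ae' ee' ee'0 an fa lam0 lam1.
have dr0 : 0 < Num.min del (r / 12) by rewrite lt_min del0 divr_gt0.
have [k zk] : exists k, (dist (z k) a < (Num.min del (r / 12))%:E)%E.
  have nb : nbhs 0%E [set y : \bar R | (y < (Num.min del (r / 12))%:E)%E].
    by apply: open_nbhs_nbhs; split; [exact: open_ereal_lt_ereal | rewrite /= lte_fin].
  by have [k _ Hk] := zcvg _ nb; exists k; apply: Hk => /=.
pose dk := fine (dist (z k) a).
have dkE : dist (z k) a = dk%:E.
  by rewrite /dk fineK// ge0_fin_numE ?dist_ge0// (lt_trans zk)// ltry.
have dpos : 0 < dk.
  rewrite -lte_fin -dkE dist_sym; apply: dist_gt0; first lra.
  by move=> h; apply: (za k).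
move: zk; rewrite dkE lte_fin lt_min => /andP[dkdel dkr].
have [y [ry [zn yn] Cdk zy ay]] := Hdel _ _ dkE dpos dkdel.
have xy : (dist x y < (r / 2)%:E)%E.
  have : (dist x y < (r / 4 + 3 * dk)%:E)%E by apply: (dist_tri (y := a)) xa ay; lra.
  by move=> /lt_le_trans; apply; rewrite lee_fin; lra.
have ldk0 : 0 < lam * dk by rewrite mulr_gt0.
have Cldk : C * (lam * dk) <= C * dk.
  by apply: ler_wpM2l; [exact: ltW | rewrite ler_piMl// ltW].
apply: noA; exists y, (lam * dk / 2); split => //; first by rewrite divr_gt0.
move=> p Pp yp.
have yn' : `|y| <= eta0 by lra.
have pn : `|p - y| <= C * (lam * dk / 2) by apply: dist_norm yp => //; lra.
have pnorm : `|p| <= eta0 by have := ler_normD (p - y) y; rewrite subrK; lra.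
have zp : (dist (z k) p < (lam * dk / 2 + lam * dk / 2)%:E)%E.
  by apply: (dist_tri (y := y)) zy yp => //; lra.
have : (dball dist (z k) (lam%:E * dist (z k) a)%E `&` P) p.
  by split => //; rewrite /dball /= dkE -EFinM [lam * dk]splitr.
by rewrite zP.
Qed.

Hypothesis sigma_le : sigma <= 2^-1.
Hypothesis sigma_eta : sigma <= eta0 / 4.

(** Apply [escape_porous] to the porous sets F 0, F 1, ... in turn; the limit of
    the centres lies in the slab and in none of the F k. *)
Lemma slab_not_sigma_porous : ~ sigma_porous dist (slab sigma i0).
Proof.
move=> [F [Fpor Feq]].
pose state := ((nat -> R) * E * R)%type.
pose ok (st : state) := stage_ok st.1.1 st.1.2 st.2.
have [t0 rt0 /andP[t00 t0s]] := base_robust sigma0.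
pose x0 : E := t0 *: delta_mx 0 i0.
pose m0 := Num.min (Num.min (eta0 / 8) 2^-1) (Num.min t0 (sigma - t0)).
pose r0 := m0 / C.
have Cr0 : C * r0 = m0 by rewrite /r0 mulrCA mulfV ?mulr1// gt_eqF.
have m00 : 0 < m0 by rewrite !lt_min divr_gt0// t00 subr_gt0 t0s invr_gt0 ltr0n.
have m01 : m0 <= eta0 / 8 by rewrite !ge_min lexx.
have m02 : m0 <= 2^-1 by rewrite !ge_min lexx orbT.
have m03 : m0 <= t0 by rewrite !ge_min lexx !orbT.
have m04 : m0 <= sigma - t0 by rewrite !ge_min lexx !orbT.
have x0t : `|x0| <= t0.
  apply: normr_le_coord => [|j]; first exact: ltW.
  rewrite !mxE; case: (_ && _); rewrite ?mulr1 ?mulr0 ?normr0; last exact: ltW.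
  by rewrite gtr0_norm.
have x0i : x0 0 i0 = t0 by rewrite !mxE !eqxx mulr1.
have seta := sigma_eta; have shalf := sigma_le; have etap := eta00.
have ok0 : ok (base_gap, x0, r0).
  split; [exact: base_admissible | by rewrite x0i | by rewrite divr_gt0 |].
  rewrite Cr0; lra.
have /choice[f Hf] (ks : nat * state) : exists st' : state, ok ks.2 -> ok st' /\
  [/\ forall m, ks.2.1.1 m <= st'.1.1 m, st'.2 <= ks.2.2 / 4,
     (dist ks.2.1.2 st'.1.2 < (ks.2.2 / 2)%:E)%E &
     forall a : E, far_from_grid sigma st'.1.1 (a 0 i0) -> (dist st'.1.2 a < st'.2%:E)%E -> ~ F ks.1 a].
  case: ks => k [[e x] r] /=.
  have [okst|nok] := pselect (ok (e, x, r)); last by exists (e, x, r).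
  have [e' [x' [r' [ok' H]]]] := escape_porous (Fpor k) okst.
  by exists (e', x', r').
pose S := fix S k : state := if k is k'.+1 then f (k', S k') else (base_gap, x0, r0).
have okS k : ok (S k).
  by elim: k => [|k IH] //; have [] := Hf (k, S k) IH.
have stepS k := (Hf (k, S k) (okS k)).2.
pose e k := (S k).1.1; pose x k := (S k).1.2; pose r k := (S k).2.
have okS' k : stage_ok (e k) (x k) (r k) := okS k.
have r_gt0 k : 0 < r k by have [] := okS' k.
have xk k : `|x k| <= eta0.
  have [_ _ rk h] := okS' k; have : 0 < C * r k by rewrite mulr_gt0.
  lra.
have r4 k : r k.+1 <= r k / 4 by have [] := stepS k.
have xd k : (dist (x k) (x k.+1) < (r k / 2)%:E)%E by have [] := stepS k.
have Cr00 : C * r 0%N <= eta0 by rewrite /r /= Cr0; lra.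
have [xoo xcvg xoor] := dist_complete xk r_gt0 r4 Cr00 xd.
have emono j k m : (j <= k)%N -> e j m <= e k m.
  elim: k => [|k IH]; first by rewrite leqn0 => /eqP ->.
  rewrite leq_eqVlt => /orP[/eqP->//|/IH jk].
  by apply: le_trans jk _; have [h _ _ _] := stepS k; exact: h.
have xfar j : far_from_grid sigma (e j) (xoo 0 i0).
  have cl := @far_closed R sigma (e j).
  have cvi : (x k 0 i0) @[k --> \oo] --> xoo 0 i0.
    apply: (@cvg_comp _ _ _ x (fun y : E => y 0 i0) _ _ _ xcvg).
    exact: coord_continuous.
  apply: (@closed_cvg _ _ _ _ (fun k => x k 0 i0) _ cl _ _ cvi).
  exists j => // k /= jk.
  have [_ rk _ _] := okS' k.
  by apply: far_mono (robust_far sigma0 rk) => // m; exact: emono.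
have xin : slab sigma i0 xoo.
  have d0 : `|xoo - x0| <= m0.
    by rewrite -Cr0; apply: dist_norm (xoor 0%N); rewrite ?Cr0; lra.
  have xn : `|xoo| <= 1 by have := ler_normD (xoo - x0) x0; rewrite subrK; lra.
  split; last exact: (xfar 0%N).
  - by move=> i; exact: le_trans (normr_coord _ i) xn.
  - have := le_trans (normr_coord _ i0) d0; rewrite !mxE !eqxx mulr1.
    by move=> /ler_normlP[h1 h2]; apply/andP; split; lra.
rewrite Feq in xin; have [k _ Fk] := xin.
have [_ _ _ H] := stepS k.
exact: (H xoo (xfar k.+1) (xoor k.+1) Fk).
Qed.
End baire.

(** * The theorem *)

Theorem theorem3p2 (R : realType) (n s : nat) (G : carnotGroup R n s) :
  exists A : set 'rV[R]_n,
    [/\ closed A,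
        nowhere_dense A,
        lebesgue_outer A = 0%E &
        ~ sigma_porous (cc_dist G) A].
Proof.
have [i0 i01] : exists i, cdeg G i = 1%N by apply: (clayer_neq0 G); rewrite leqnn (cstep_gt0 G).
have [rho [rho1 [rho0 rho10 X2 Xi0 small]]] := local_frame G i0.
pose C : R := n%:R * 2.
pose eta0 := Num.min (rho / 2) rho1.
pose sigma := Num.min 2^-1 (eta0 / 4).
have n0 : (0 < n)%N by exact: leq_ltn_trans (leq0n _) (ltn_ord i0).
have C1 : 1 <= C by rewrite /C -natrM (ler_nat R 1) muln_gt0 n0.
have eta00 : 0 < eta0 by rewrite lt_min divr_gt0.
have eta_rho : eta0 <= rho / 2 by rewrite ge_min lexx.
have eta_rho1 : eta0 <= rho1 by rewrite ge_min lexx orbT.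
have two0 : (0:R) < 2 by exact: ltr0n.
have sigma0 : 0 < sigma by rewrite lt_min invr_gt0 two0 divr_gt0.
have ge0 x y : (0 <= cc_dist G x y)%E.
  apply: le_ereal_inf_tmp => _ [g [u [_ _ _ ->]]].
  by apply: integral_ge0 => t _; rewrite lee_fin sqrtr_ge0.
exists (slab sigma i0); split.
- exact: slab_closed.
- exact: slab_nowhere_dense.
- exact: slab_null.
apply: (@slab_not_sigma_porous _ _ (cc_dist G) i0 C eta0 sigma sigma0 C1 eta00 ge0).
- move=> x; apply/eqP; rewrite eq_le ge0 andbT.
  by have := cc_dist_le_hlength (horizontal_cst G 0 1 x); rewrite hlength_cst.
- exact: cc_distC.
- move=> x y r xe re; apply: (norm_le_cc_dist two0 X2); first exact: le_trans xe eta_rho.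
  exact: le_trans re eta_rho.
- move=> x y z r1 r2 xe ye ze r1e r2e.
  by apply: (cc_dist_triangle_local two0 rho0 X2 n0); apply: le_trans eta_rho.
- move=> x t xe te; apply: (cc_dist_move_coord i01 X2 Xi0 small); exact: le_trans eta_rho1.
- move=> x r xe r0 r4 Cr xd; apply: (cc_dist_complete two0 rho0 X2) => //.
    by move=> k; exact: le_trans eta_rho.
  exact: le_trans eta_rho.
- by rewrite ge_min lexx.
- by rewrite ge_min lexx orbT.
Qed.
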